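(* Let $d\ge3$. There exists $\eta>0$ such that for $\mathbb{P}$-a.e. $\omega$ the quenched large deviation principle for $X_n/n$ under $P_{0,0}^\omega$ holds in the $\eta$-neighborhood of $\xi_o$ with rate function $I_c$: for every Borel set $G$ contained in $\{\xi:|\xi-\xi_o|<\eta\}$, $$-\inf_{\xi\in G^o}I_c(\xi)\le\liminf_{n\to\infty}\frac1n\log P_{0,0}^\omega\left(\tfrac{X_n}{n}\in G\right)\le\limsup_{n\to\infty}\frac1n\log P_{0,0}^\omega\left(\tfrac{X_n}{n}\in G\right)\le-\inf_{\xi\in\bar G}I_c(\xi).$$
   Context: Space-time RWRE: environment $\omega=(\omega_{n,x})_{n\in\mathbb{Z},x\in\mathbb{Z}^d}$ with $\omega_{n,x}=(\pi_{n,n+1}(x,x+z))_{z\in U}$ probability vectors, $U:=\{z\in\mathbb{Z}^d:|z_1|+\cdots+|z_d|=1\}$; under $\mathbb{P}$ the $\omega_{n,x}$ are i.i.d., and there is $c_1>0$ with $\mathbb{P}(\pi_{0,1}(0,z)\ge c_1)=1$ for all $z\in U$. $P_{k,x}^\omega$ is the law of the walk $(X_n)_{n\ge k}$ with $X_k=x$ and $P(X_{n+1}=y+z\mid X_n=y)=\pi_{n,n+1}(y,y+z)$. $q(z):=\mathbb{E}[\pi_{0,1}(0,z)]$, $\xi_o:=\sum_{z\in U}q(z)z$, $\Lambda_c(\theta):=\log\sum_{z\in U}q(z)\mathrm{e}^{\langle\theta,z\rangle}$, and $I_c(\xi):=\sup_\theta\{\langle\theta,\xi\rangle-\Lambda_c(\theta)\}$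 (the averaged rate function). *)

(* Defs.v *)
From HB Require Import structures.
From mathcomp Require Import all_boot all_order all_algebra.
From mathcomp Require Import all_classical all_reals all_analysis.
Set Implicit Arguments. Unset Strict Implicit. Unset Printing Implicit Defensive.
Import Order.TTheory GRing.Theory Num.Theory.
Import numFieldNormedType.Exports.
Local Open Scope classical_set_scope.
Local Open Scope ring_scope.

(* The set U = {z in Z^d : |z_1|+...+|z_d| = 1} of nearest-neighbour steps,
   enumerated as (i, b) |-> +e_i (b = true) or -e_i (b = false). *)
Definition step (d : nat) := ('I_d * bool)%type.

Definition stepvec (d : nat) (z : step d) : 'rV[int]_d :=
  (if z.2 then 1 else -1) *: delta_mx 0 z.1.

Definition cyl_sigma (R : realType) (d : nat) : set (set (step d -> R)) :=
  <<s [set A | exists z (B : set R), measurable B /\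
                 A = (fun v : step d -> R => v z) @^-1` B] >>.

(* A space-time environment: omega n x t z = pi_{n,n+1}(x, x+z) in sample t. *)
Definition env_key (d : nat) := (int * 'rV[int]_d)%type.

Definition env_independent (R : realType) (d : nat) (dT : measure_display)
  (T : measurableType dT) (P : probability T R)
  (omega : int -> 'rV[int]_d -> T -> step d -> R) : Prop :=
  forall (s : seq (env_key d)) (C : env_key d -> set (step d -> R)),
    uniq s -> (forall k, k \in s -> @cyl_sigma R d (C k)) ->
    P (\big[setI/setT]_(k <- s) (omega k.1 k.2 @^-1` C k)) =
    (\prod_(k <- s) P (omega k.1 k.2 @^-1` C k))%E.

Definition env_identically_distributed (R : realType) (d : nat)
  (dT : measure_display) (T : measurableType dT) (P : probability T R)
  (omega : int -> 'rV[int]_d -> T -> step d -> R) : Prop :=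
  forall (n : int) (x : 'rV[int]_d) (C : set (step d -> R)),
    @cyl_sigma R d C -> P (omega n x @^-1` C) = P (omega 0 0 @^-1` C).

Definition walk_pos (d n : nat) (s : {ffun 'I_n -> step d}) (k : nat) : 'rV[int]_d :=
  \sum_(j < n | (j < k)%N) stepvec (s j).

Definition quenched_prob (R : realType) (d : nat) (dT : measure_display)
  (T : measurableType dT) (omega : int -> 'rV[int]_d -> T -> step d -> R)
  (t : T) (n : nat) (G : set 'rV[R]_d) : R :=
  \sum_(s : {ffun 'I_n -> step d})
     (\prod_(k < n) omega (k%:Z) (walk_pos s k) t (s k)) *
     \1_G ((n%:R)^-1 *: map_mx (fun a : int => a%:~R) (walk_pos s n)).

Definition elog (R : realType) (p : R) : \bar R :=
  if p == 0 then -oo%E else (ln p)%:E.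

Definition qmean (R : realType) (d : nat) (dT : measure_display)
  (T : measurableType dT) (P : probability T R)
  (omega : int -> 'rV[int]_d -> T -> step d -> R) (z : step d) : R :=
  fine (\int[P]_t (omega 0 0 t z)%:E)%E.

Definition dotR (R : realType) (d : nat) (u v : 'rV[R]_d) : R :=
  \sum_(i < d) u 0 i * v 0 i.

Definition zvec (R : realType) (d : nat) (z : step d) : 'rV[R]_d :=
  map_mx (fun a : int => a%:~R) (stepvec z).

Definition xi_o (R : realType) (d : nat) (q : step d -> R) : 'rV[R]_d :=
  \sum_(z : step d) q z *: zvec R z.

Definition Lambda_c (R : realType) (d : nat) (q : step d -> R) (th : 'rV[R]_d) : R :=
  ln (\sum_(z : step d) q z * expR (dotR th (zvec R z))).

Definition I_c (R : realType) (d : nat) (q : step d -> R) (xi : 'rV[R]_d) : \bar R :=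
  ereal_sup [set ((dotR th xi - Lambda_c q th)%:E) | th in [set: 'rV[R]_d]].

Definition borel_set (R : realType) (d : nat) (G : set 'rV[R]_d) : Prop :=
  <<s [set O : set 'rV[R]_d | open O] >> G.

Definition eucl (R : realType) (d : nat) (v : 'rV[R]_d) : R :=
  Num.sqrt (\sum_(i < d) v 0 i ^+ 2).

Definition ldp_seq (R : realType) (d : nat) (dT : measure_display)
  (T : measurableType dT) (omega : int -> 'rV[int]_d -> T -> step d -> R)
  (t : T) (G : set 'rV[R]_d) : nat -> \bar R :=
  fun n => (((n%:R)^-1)%:E * elog (quenched_prob omega t n G))%E.

(* Main.v *)
(* For a tilt theta let Z_L(m, x) be the point-to-plane partition function of
   length L started at (m, x), with weights pi * e^(theta.z) normalised so that
   its mean is 1.  Expanding over two replicas, E[Z_L(m,x) Z_L(m,y)] is governed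
   by the difference walk of two independent tilted walks, perturbed only at the
   origin, by a total weight that tends to 1 as theta -> 0.  In dimension d >= 3
   the function psi(v) = (a + <v, Sigma^-1 v>)^(-1/4) is superharmonic for the
   difference walk, and its strict maximum at 0 absorbs the perturbation for
   small theta, so that E[Z_L(m,x) Z_L(m,y)] <= 1 + psi(x - y).  Since psi decays,
   the average of Z_L(m, .) over k^2 starting points at mutual distance at least
   2 k^4 has variance O(k^-2): almost surely, for all large k, one of these points
   has Z >= 1/2 with L ~ k^7, and by uniform ellipticity it can be reached from
   the origin at cost e^(-o(k^7)).  With the first-moment upper bound this
   identifies the quenched logarithmic moment generating function with Lambda_c
   near 0, simultaneously for all rational theta, and a local Gaertner-Ellis
   argument concludes. *)

Require Import Defs.
From HB Require Import structures.
From mathcomp Require Import all_boot all_order all_algebra.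
From mathcomp Require Import all_classical all_reals all_analysis measurable_realfun.
From mathcomp Require Import ring lra zify.
Set Implicit Arguments. Unset Strict Implicit. Unset Printing Implicit Defensive.
Import Order.TTheory GRing.Theory Num.Theory.
Import numFieldNormedType.Exports.
Local Open Scope classical_set_scope.
Local Open Scope ring_scope.

(** * Bounded random variables and their expectations *)

Section bounded_expectation.
Context (R : realType) (dT : measure_display) (T : measurableType dT).
Context (P : probability T R).
Implicit Types X Y : T -> R.

(** The obstacle is that the bound 1 + psi leaves a variance of order one: by itself it makes Z
    large only with positive probability. Averaging over remote starting points turns this into an
    error that is summable in k, and this dictates the exponents. Since psi(v) decays like
    |v|^(-1/2), spacing 2 k^4 makes each covariance at most k^(-2), so that all off-diagonal terms
    together weigh no more than the k^2 diagonal ones. The farthest point is within 2 k^6 steps,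
    negligible against k^7, and so is the gap between k^7 and (k+1)^7, so that every time n is
    served by some block. The bound holds for each finite length by induction on the length; no
    martingale limit and no conditional expectation enters. Independence is used only for finite
    products over distinct space-time sites, and what replaces the filtration is a class of
    polynomials in the environment after a given time. *)

Definition bounded_rv X := measurable_fun setT X /\ exists C, forall t, `|X t| <= C.

Definition Ex X : R := \int[P]_t X t.

Lemma bounded_rv_integrable X : bounded_rv X -> P.-integrable setT (EFin \o X).
Proof.
move=> [mX [C hC]]; apply: measurable_bounded_integrable => //.
  by rewrite -ge0_fin_numE// fin_num_measure.
by exists C; split => [|y Cy t _]; [exact: num_real|exact: le_trans (hC t) (ltW Cy)].
Qed.

Lemma bounded_rv_cst c : bounded_rv (fun=> c).
Proof. by split; [exact: measurable_cst | exists `|c|]. Qed.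

Lemma bounded_rvD X Y : bounded_rv X -> bounded_rv Y -> bounded_rv (fun t => X t + Y t).
Proof.
move=> [mX [C hC]] [mY [D hD]]; split; first exact: measurable_funD.
by exists (C + D) => t; rewrite (le_trans (ler_normD _ _))// lerD.
Qed.

Lemma bounded_rvM X Y : bounded_rv X -> bounded_rv Y -> bounded_rv (fun t => X t * Y t).
Proof.
move=> [mX [C hC]] [mY [D hD]]; split; first exact: measurable_funM.
by exists (C * D) => t; rewrite normrM ler_pM.
Qed.

Lemma bounded_rvZ c X : bounded_rv X -> bounded_rv (fun t => c * X t).
Proof. by move=> hX; apply: bounded_rvM => //; exact: bounded_rv_cst. Qed.

Lemma bounded_rv_sum (I : Type) (r : seq I) (F : I -> T -> R) :
  (forall i, bounded_rv (F i)) -> bounded_rv (fun t => \sum_(i <- r) F i t).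
Proof.
move=> hF; elim: r => [|i r IH].
  by under eq_fun do rewrite big_nil; exact: bounded_rv_cst.
by under eq_fun do rewrite big_cons; exact: bounded_rvD.
Qed.

Lemma measurable_superlevel (X : T -> R) c :
  measurable_fun setT X -> measurable [set t | c <= X t].
Proof.
move=> mX.
have -> : [set t | c <= X t] = X @^-1` `[c, +oo[%classic.
  by apply/seteqP; split => t /=; rewrite in_itv /= andbT.
by rewrite -[X in measurable X]setTI; exact: mX.
Qed.

Lemma bounded_rv_indic A : measurable A -> bounded_rv (\1_A : T -> R).
Proof.
move=> mA; split; first exact: measurable_indic.
by exists 1 => t; rewrite indicE; case: (_ \in _); rewrite ?normr1 ?normr0.
Qed.

Lemma bounded_rv_ge (X : T -> R) c : measurable_fun setT X ->
  bounded_rv (fun t => (c <= X t)%R%:R).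
Proof.
move=> mX; split; last by exists 1 => t; case: (c <= X t); rewrite ?normr1 ?normr0.
have -> : (fun t => (c <= X t)%R%:R) = \1_(X @^-1` `[c, +oo[%classic) :> (T -> R).
  apply/funext => t; rewrite indicE; congr (nat_of_bool _)%:R.
  apply/idP/idP; first by move=> h; rewrite inE /= in_itv /= h.
  by rewrite inE /= in_itv /= andbT.
by apply: measurable_indic; rewrite -[X in measurable X]setTI; exact: mX.
Qed.

Lemma Ex_cst c : Ex (fun=> c) = c.
Proof.
rewrite /Ex Rintegral_cst// -[RHS]mulr1; congr (_ * _).
by rewrite -[RHS]/(fine 1%:E); congr fine; exact: probability_setT.
Qed.

Lemma ExD X Y : bounded_rv X -> bounded_rv Y -> Ex (fun t => X t + Y t) = Ex X + Ex Y.
Proof. by move=> hX hY; rewrite /Ex RintegralD//; exact: bounded_rv_integrable. Qed.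

Lemma ExZ c X : bounded_rv X -> Ex (fun t => c * X t) = c * Ex X.
Proof. by move=> hX; rewrite /Ex RintegralZl//; exact: bounded_rv_integrable. Qed.

Lemma ExB X Y : bounded_rv X -> bounded_rv Y -> Ex (fun t => X t - Y t) = Ex X - Ex Y.
Proof. by move=> hX hY; rewrite /Ex RintegralB//; exact: bounded_rv_integrable. Qed.

Lemma Ex_sum (I : Type) (r : seq I) (F : I -> T -> R) :
  (forall i, bounded_rv (F i)) ->
  Ex (fun t => \sum_(i <- r) F i t) = \sum_(i <- r) Ex (F i).
Proof.
move=> hF; elim: r => [|i r IH].
  by under eq_fun do rewrite big_nil; rewrite Ex_cst big_nil.
by under eq_fun do rewrite big_cons; rewrite ExD ?IH ?big_cons//; exact: bounded_rv_sum.
Qed.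

Lemma le_Ex X Y : bounded_rv X -> bounded_rv Y -> (forall t, X t <= Y t) -> Ex X <= Ex Y.
Proof. by move=> hX hY h; apply: le_Rintegral => //; exact: bounded_rv_integrable. Qed.

Lemma Ex_ge0 X : (forall t, 0 <= X t) -> 0 <= Ex X.
Proof. by move=> h; apply: Rintegral_ge0 => t _. Qed.

Lemma Ex_indic A : measurable A -> (Ex (\1_A))%:E = P A.
Proof.
move=> mA; rewrite /Ex /Rintegral integral_indic// setIT fineK//.
by rewrite fin_num_measure.
Qed.

Lemma markov_ge X c : 0 < c -> bounded_rv X -> (forall t, 0 <= X t) ->
  (P [set t | (c <= X t)%R] <= (Ex X / c)%:E)%E.
Proof.
move=> c0 bX X0.
have mA := measurable_superlevel c bX.1.
rewrite -Ex_indic// lee_fin ler_pdivlMr// mulrC -ExZ; last exact: bounded_rv_indic.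
apply: le_Ex => //; first exact/bounded_rvZ/bounded_rv_indic.
move=> t; rewrite indicE; case: (boolP (t \in _)) => [|_]; last by rewrite mulr0.
by rewrite inE /= mulr1.
Qed.

(* The step function [sum_j 1(j+1 <= y)] is [floor y] on [0, N]. *)
Lemma sum_floor_approx (N : nat) (y : R) : 0 <= y ->
  (N%:R <= y -> \sum_(j < N) (j.+1%:R <= y)%R%:R = N%:R :> R) /\
  (y < N%:R -> y - 1 <= \sum_(j < N) (j.+1%:R <= y)%R%:R <= y).
Proof.
move=> y0; elim: N => [|N [IH1 IH2]].
  by split => h; rewrite big_ord0//; move: h; rewrite ltNge y0.
rewrite big_ord_recr /= -natr1; split => h.
  by rewrite h IH1//; move: h; lra.
rewrite (_ : (N%:R + 1 <= y)%R = false) ?addr0; last by apply/negbTE; rewrite -ltNge.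
have [hN|hN] := ltP y N%:R; first exact: IH2.
by rewrite IH1//; move: h; lra.
Qed.

(** An identity known for all superlevel indicators of [X] and [X'] passes to the variables
    themselves by uniform approximation. This is the bridge from hypotheses on events to
    expectations: it serves independence with [X' = X] and [Y' = 1], and equality of laws with
    [a = 1]. *)
Lemma Ex_layer X X' Y Y' (a : R) :
  bounded_rv X -> bounded_rv X' -> bounded_rv Y -> bounded_rv Y' ->
  (forall t, 0 <= X t <= 1) -> (forall t, 0 <= X' t <= 1) ->
  (forall c, Ex (fun t => (c <= X t)%R%:R * Y t) =
             a * Ex (fun t => (c <= X' t)%R%:R * Y' t)) ->
  Ex (fun t => X t * Y t) = a * Ex (fun t => X' t * Y' t).
Proof.
move=> bX bX' bY bY' X01 X'01 h.
(* [S Z N] is floor((N+1) Z)/(N+1) written as an average of superlevel indicators, hence within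
   1/(N+1) of [Z]. *)
pose S (Z : T -> R) N t : R := N.+1%:R^-1 * \sum_(j < N.+1) (j.+1%:R / N.+1%:R <= Z t)%R%:R.
have N0 (N : nat) : 0 < N.+1%:R :> R by [].
have bS Z N : bounded_rv Z -> bounded_rv (S Z N).
  by move=> bZ; apply: bounded_rvZ; apply: bounded_rv_sum => i; exact: bounded_rv_ge bZ.1.
have approx Z W : bounded_rv Z -> bounded_rv W -> (forall t, 0 <= Z t <= 1) ->
    exists C, forall N, `|Ex (fun t => Z t * W t) - Ex (fun t => S Z N t * W t)| <= C / N.+1%:R.
  move=> bZ bW Z01; have [mW [C hC]] := bW; exists C => N.
  rewrite -ExB; [|exact: bounded_rvM|by apply: bounded_rvM => //; exact: bS].
  have hb t : `|Z t * W t - S Z N t * W t| <= C / N.+1%:R.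
    rewrite -mulrBl normrM mulrC; apply: ler_pM => //.
    have /andP[z0 z1] := Z01 t.
    have [h1 h2] := @sum_floor_approx N.+1 (N.+1%:R * Z t) (mulr_ge0 (ltW (N0 N)) z0).
    have -> : Z t - S Z N t =
        N.+1%:R^-1 * (N.+1%:R * Z t - \sum_(j < N.+1) (j.+1%:R <= N.+1%:R * Z t)%R%:R).
      rewrite mulrBr mulKf ?gt_eqF//; congr (_ - _ * _); apply: eq_bigr => j _.
      by rewrite ler_pdivrMr// mulrC.
    rewrite normrM gtr0_norm ?invr_gt0// -[leRHS]mulr1 ler_pM2l ?invr_gt0//.
    rewrite ler_norml; have [|hh] := ltP (N.+1%:R * Z t) N.+1%:R.
      by move=> /h2; lra.
    rewrite (h1 hh); have : N.+1%:R * Z t <= N.+1%:R by rewrite ler_piMr// ltW.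
    by move: hh; lra.
  have bD : bounded_rv (fun t => Z t * W t - S Z N t * W t).
    have -> : (fun t => Z t * W t - S Z N t * W t) = (fun t => Z t * W t + (- 1) * (S Z N t * W t)).
      by apply/funext => t; rewrite mulN1r.
    by apply: bounded_rvD; [exact: bounded_rvM|apply: bounded_rvZ; apply: bounded_rvM => //; exact: bS].
  rewrite ler_norml; apply/andP; split.
    rewrite -[leLHS]Ex_cst; apply: le_Ex => //; first exact: bounded_rv_cst.
    by move=> t; have := hb t; rewrite ler_norml => /andP[].
  rewrite -[leRHS]Ex_cst; apply: le_Ex => //; first exact: bounded_rv_cst.
  by move=> t; have := hb t; rewrite ler_norml => /andP[].
have ES Z W N : bounded_rv Z -> bounded_rv W -> Ex (fun t => S Z N t * W t) =
    N.+1%:R^-1 * \sum_(j < N.+1) Ex (fun t => (j.+1%:R / N.+1%:R <= Z t)%R%:R * W t).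
  move=> bZ bW.
  have bb (i : 'I_N.+1) : bounded_rv (fun t => (i.+1%:R / N.+1%:R <= Z t)%R%:R * W t).
    by apply: bounded_rvM => //; exact: bounded_rv_ge bZ.1.
  rewrite -Ex_sum// -ExZ; last exact: bounded_rv_sum.
  by congr Ex; apply/funext => t; rewrite /S -mulrA mulr_suml.
have [C hC] := approx _ _ bX bY X01; have [C' hC'] := approx _ _ bX' bY' X'01.
apply/eqP; rewrite -subr_eq0 -normr_le0; apply/ler_addgt0Pr => e e0; rewrite add0r.
have [N hN] : exists N : nat, (C + `|a| * C') / N.+1%:R <= e.
  exists (Num.truncn ((C + `|a| * C') / e)).
  by rewrite ler_pdivrMr// -ler_pdivrMl// mulrC ltW// truncnS_gt.
apply: le_trans hN.
have -> : Ex (fun t => X t * Y t) - a * Ex (fun t => X' t * Y' t) =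
   (Ex (fun t => X t * Y t) - Ex (fun t => S X N t * Y t)) -
   a * (Ex (fun t => X' t * Y' t) - Ex (fun t => S X' N t * Y' t)).
  rewrite (ES X)// (ES X')//; under eq_bigr do rewrite h.
  by rewrite -mulr_sumr; ring.
rewrite (le_trans (ler_normB _ _))// mulrDl lerD// normrM -mulrA ler_wpM2l//.
Qed.

End bounded_expectation.

(** * Independence across time slices *)

Section independence.
Context (R : realType) (d : nat) (dT : measure_display) (T : measurableType dT).
Context (P : probability T R) (omega : int -> 'rV[int]_d -> T -> step d -> R).
Context (indep : env_independent P omega) (ident : env_identically_distributed P omega).
Local Notation E := (Ex P).
Local Notation key := (env_key d).
Implicit Types (k : key) (s : seq key).

Definition env k t := omega k.1 k.2 t.

Definition cyl_measurable (f : (step d -> R) -> R) :=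
  forall B, measurable B -> cyl_sigma (f @^-1` B).

Definition slice_fun k (f : (step d -> R) -> R) :=
  [/\ cyl_measurable f, measurable_fun setT (fun t => f (env k t)) &
      forall t, 0 <= f (env k t) <= 1].

Lemma cyl_measurable_coord z : cyl_measurable (fun v => v z).
Proof. by move=> B mB; apply: sub_sigma_algebra; exists z, B. Qed.

(** Products of two coordinates arise when both replicas occupy one site. The function space is
    given the generated sigma-algebra so that measurability of products of real functions
    applies. *)
Lemma cyl_measurableM f g : cyl_measurable f -> cyl_measurable g ->
  cyl_measurable (fun v => f v * g v).
Proof.
pose G := [set A : set (step d -> R) | exists z (B : set R), measurable B /\
                 A = (fun v : step d -> R => v z) @^-1` B].
move=> mf mg B mB.
have mf' : measurable_fun setT (f : g_sigma_algebraType G -> R).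
  by move=> _ A mA; rewrite setTI; exact: mf.
have mg' : measurable_fun setT (g : g_sigma_algebraType G -> R).
  by move=> _ A mA; rewrite setTI; exact: mg.
by have := measurable_funM mf' mg' measurableT mB; rewrite setTI.
Qed.

Lemma slice_fun_bounded k f : slice_fun k f -> bounded_rv (fun t => f (env k t)).
Proof.
by move=> [_ mf f01]; split=> //; exists 1 => t; have /andP[? ?] := f01 t; rewrite ger0_norm.
Qed.

Lemma prod_bounded s (F : key -> T -> R) : (forall k, k \in s -> bounded_rv (F k)) ->
  bounded_rv (fun t => \prod_(k <- s) F k t).
Proof.
elim: s => [|k s IH] h; first by under eq_fun do rewrite big_nil; exact: bounded_rv_cst.
under eq_fun do rewrite big_cons; apply: bounded_rvM; first by apply: h; rewrite mem_head.
by apply: IH => j js; apply: h; rewrite in_cons js orbT.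
Qed.

Lemma Ex_prod_indicators s (g : key -> (step d -> R) -> R) (c : key -> R) :
  uniq s -> (forall k, k \in s -> slice_fun k (g k)) ->
  E (fun t => \prod_(k <- s) (c k <= g k (env k t))%R%:R) =
  \prod_(k <- s) E (fun t => (c k <= g k (env k t))%R%:R).
Proof.
move=> us hs.
pose C k := g k @^-1` `[c k, +oo[%classic.
have CE k t : (c k <= g k (env k t))%R%:R = \1_(omega k.1 k.2 @^-1` C k) t :> R.
  rewrite indicE; congr (nat_of_bool _)%:R; apply/idP/idP.
    by move=> h; rewrite inE /C /= in_itv /= andbT.
  by rewrite inE /C /= in_itv /= andbT.
have mC k : k \in s -> measurable (omega k.1 k.2 @^-1` C k).
  move=> ks; have [_ mf _] := hs k ks.
  by have := mf measurableT `[c k, +oo[%classic (measurable_itv _); rewrite setTI.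
have -> : (fun t => \prod_(k <- s) (c k <= g k (env k t))%R%:R) =
    \1_(\big[setI/setT]_(k <- s) (omega k.1 k.2 @^-1` C k)) :> (T -> R).
  apply/funext => t; under eq_bigr do rewrite CE.
  elim: s {us hs mC} => [|k s IH]; first by rewrite !big_nil indicE in_setT.
  by rewrite !big_cons IH indicI.
apply: EFin_inj; rewrite Ex_indic; last first.
  elim: s us hs mC => [|k s IH] us hs mC; first by rewrite big_nil.
  rewrite big_cons; apply: measurableI; first by apply: mC; rewrite mem_head.
  apply: IH => [|j js|j js]; first by case/andP: us.
    by apply: hs; rewrite in_cons js orbT.
  by apply: mC; rewrite in_cons js orbT.
rewrite indep//; last by move=> k ks; have [mg _ _] := hs k ks; apply: mg; exact: measurable_itv.
rewrite -prodEFin; apply: eq_big_seq => k ks.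
rewrite -Ex_indic; last exact: mC.
by congr (Ex P _)%:E; apply/funext => t; rewrite CE.
Qed.

(** Indicators are traded for functions one site at a time: [Ex_layer] replaces the head function of
    [s1] by an arbitrary superlevel indicator, which moves its site into [s2], where the induction
    hypothesis applies. *)
Lemma Ex_prod_mixed s1 s2 (g : key -> (step d -> R) -> R) (c : key -> R) :
  uniq (s1 ++ s2) -> (forall k, k \in s1 ++ s2 -> slice_fun k (g k)) ->
  E (fun t => \prod_(k <- s1) g k (env k t) * \prod_(k <- s2) (c k <= g k (env k t))%R%:R) =
  \prod_(k <- s1) E (fun t => g k (env k t)) *
  \prod_(k <- s2) E (fun t => (c k <= g k (env k t))%R%:R).
Proof.
elim: s1 s2 c => [|k s1 IH] s2 c us hs.
  rewrite big_nil mul1r -Ex_prod_indicators//.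
  by congr Ex; apply/funext => t; rewrite big_nil mul1r.
have kk : slice_fun k (g k) by apply: hs; rewrite mem_head.
have us' : uniq (s1 ++ s2) by case/andP: us.
have hs' j : j \in s1 ++ s2 -> slice_fun j (g j).
  by move=> js; apply: hs; rewrite in_cons js orbT.
have bs1 : bounded_rv (fun t => \prod_(j <- s1) g j (env j t)).
  apply: (@prod_bounded s1 (fun j t => g j (env j t))) => j js.
  by apply/slice_fun_bounded/hs'; rewrite mem_cat js.
have bs2 : bounded_rv (fun t => \prod_(j <- s2) (c j <= g j (env j t))%R%:R : R).
  apply: (@prod_bounded s2 (fun j t => (c j <= g j (env j t))%R%:R : R)) => j js.
  apply: bounded_rv_ge.
  by have [] : slice_fun j (g j) by apply: hs'; rewrite mem_cat js orbT.
have [_ mk k01] := kk.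
pose W t := \prod_(j <- s1) g j (env j t) * \prod_(j <- s2) (c j <= g j (env j t))%R%:R.
have bW : bounded_rv W by exact: bounded_rvM.
rewrite big_cons mulrAC -mulrA mulrC.
transitivity (E (fun t => g k (env k t) * W t)).
  by congr Ex; apply/funext => t; rewrite big_cons /W mulrA.
rewrite [X in _ = X * _](_ : _ = E W); last by rewrite IH// mulrC.
transitivity (E W * E (fun t => g k (env k t) * 1)); last first.
  by congr (_ * Ex P _); apply/funext => t; rewrite mulr1.
apply: Ex_layer => //; [exact: slice_fun_bounded|exact: slice_fun_bounded|exact: bounded_rv_cst|].
move=> b.
(* Only the threshold of the moved site changes; [k] does not occur in [s2], so the others are
   untouched. *)
pose c' j := if j == k then b else c j.
have kns : k \notin s1 ++ s2 by case/andP: us.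
have uk : uniq (s1 ++ k :: s2) by rewrite -cat1s uniq_catCA /= kns us'.
have hk j : j \in s1 ++ k :: s2 -> slice_fun j (g j).
  by move=> js; apply: hs; move: js; rewrite !(mem_cat, inE) => /or3P[] ->; rewrite ?orbT.
have c'E j : j \in s2 -> c' j = c j.
  move=> js; rewrite /c' ifN//; by apply: contraNneq kns => <-; rewrite mem_cat js orbT.
have E1 : E (fun t => (b <= g k (env k t))%R%:R * W t) =
    E (fun t => \prod_(j <- s1) g j (env j t) * \prod_(j <- k :: s2) (c' j <= g j (env j t))%R%:R).
  congr Ex; apply/funext => t; rewrite big_cons {1}/c' eqxx /W mulrCA; congr (_ * (_ * _)).
  by apply: eq_big_seq => j js; rewrite c'E.
rewrite E1 IH// big_cons {1}/c' eqxx IH//.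
have -> : (fun t => (b <= g k (env k t))%R%:R * 1) = (fun t => (b <= g k (env k t))%R%:R) :> (T -> R).
  by apply/funext => t; rewrite mulr1.
have -> : \prod_(j <- s2) E (fun t => (c' j <= g j (env j t))%R%:R) =
    \prod_(j <- s2) E (fun t => (c j <= g j (env j t))%R%:R).
  by apply: eq_big_seq => j js; rewrite c'E.
by ring.
Qed.

Lemma Ex_prod s (g : key -> (step d -> R) -> R) :
  uniq s -> (forall k, k \in s -> slice_fun k (g k)) ->
  E (fun t => \prod_(k <- s) g k (env k t)) = \prod_(k <- s) E (fun t => g k (env k t)).
Proof.
move=> us hs; have := @Ex_prod_mixed s [::] g (fun=> 0); rewrite cats0 => /(_ us hs).
rewrite big_nil mulr1 => <-; congr Ex; apply/funext => t; by rewrite big_nil mulr1.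
Qed.

Lemma Ex_ident k f : slice_fun k f -> slice_fun (0, 0) f ->
  E (fun t => f (env k t)) = E (fun t => f (env (0, 0) t)).
Proof.
move=> hk h0.
suff : E (fun t => f (env k t) * 1) = 1 * E (fun t => f (env (0, 0) t) * 1).
  rewrite mul1r; have h j : (fun t => f (env j t) * 1) = (fun t => f (env j t)).
    by apply/funext => t; rewrite mulr1.
  by rewrite !h.
have [cf mk k01] := hk; have [_ m0 k0] := h0.
apply: Ex_layer => //; [exact: slice_fun_bounded|exact: slice_fun_bounded|
  exact: bounded_rv_cst|exact: bounded_rv_cst|].
move=> c; rewrite mul1r.
have h j : measurable_fun setT (fun t => f (env j t)) ->
    (E (fun t => (c <= f (env j t))%R%:R * 1))%:E = P (omega j.1 j.2 @^-1` (f @^-1` `[c, +oo[%classic)).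
  move=> mj; rewrite -Ex_indic; last first.
    by have := mj measurableT `[c, +oo[%classic (measurable_itv _); rewrite setTI.
  congr (Ex P _)%:E; apply/funext => t; rewrite mulr1 indicE; congr (nat_of_bool _)%:R.
  apply/idP/idP; first by move=> hh; rewrite inE /= in_itv /= andbT.
  by rewrite inE /= in_itv /= andbT.
apply: EFin_inj; rewrite !h//=; apply: ident; apply: cf; exact: measurable_itv.
Qed.

(* Random variables that are polynomials in the environment at times [>= m]:
   this is all that is needed of the filtration. *)
Inductive future : nat -> (T -> R) -> Prop :=
| future_cst m c : future m (fun=> c)
| futureD m X Y : future m X -> future m Y -> future m (fun t => X t + Y t)
| futureZ m c X : future m X -> future m (fun t => c * X t)
| future_slice m s f X : uniq s -> (forall k, k \in s -> k.1 = m%:Z) ->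
    (forall k, k \in s -> slice_fun k (f k)) -> future m.+1 X ->
    future m (fun t => \prod_(k <- s) f k (env k t) * X t).

Lemma future_bounded m X : future m X -> bounded_rv X.
Proof.
elim=> {m X} [m c|m X Y _ hX _ hY|m c X _ hX|m s f X us hs hf _ hX].
- exact: bounded_rv_cst.
- exact: bounded_rvD.
- exact: bounded_rvZ.
- apply: bounded_rvM => //; apply: (@prod_bounded s (fun j t => f j (env j t))) => j js.
  exact/slice_fun_bounded/hf.
Qed.

Lemma future_sum m (I : Type) (r : seq I) (F : I -> T -> R) :
  (forall i, future m (F i)) -> future m (fun t => \sum_(i <- r) F i t).
Proof.
move=> hF; elim: r => [|i r IH].
  by under eq_fun do rewrite big_nil; exact: future_cst.
by under eq_fun do rewrite big_cons; exact: futureD.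
Qed.

(** Induction on the derivation of [future]. In the slice case the sites at time [m] join the past
    product, which then lies strictly before [m.+1]; they are disjoint from [s] because their time
    differs. *)
Lemma Ex_past_future m X s f : future m X -> uniq s ->
  (forall k, k \in s -> k.1 < m%:Z) -> (forall k, k \in s -> slice_fun k (f k)) ->
  E (fun t => \prod_(k <- s) f k (env k t) * X t) =
  (\prod_(k <- s) E (fun t => f k (env k t))) * E X.
Proof.
move=> hX; elim: hX s f => {m X}
  [m c|m X Y hX IHX hY IHY|m c X hX IHX|m s' f' X us' hs' hf' hX IHX] s f us hs hf.
- have -> : (fun t => \prod_(k <- s) f k (env k t) * c) = (fun t => c * \prod_(k <- s) f k (env k t)).
    by apply/funext => t; rewrite mulrC.
  rewrite ExZ; last first.
    by apply: (@prod_bounded s (fun j t => f j (env j t))) => j js; exact/slice_fun_bounded/hf.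
  by rewrite Ex_prod// Ex_cst mulrC.
- have bs : bounded_rv (fun t => \prod_(k <- s) f k (env k t)).
    by apply: (@prod_bounded s (fun j t => f j (env j t))) => j js; exact/slice_fun_bounded/hf.
  have bX := future_bounded hX; have bY := future_bounded hY.
  under eq_fun do rewrite mulrDr.
  rewrite (ExD P (bounded_rvM bs bX) (bounded_rvM bs bY)) (ExD P bX bY).
  by rewrite (IHX s f us hs hf) (IHY s f us hs hf) mulrDr.
- have bs : bounded_rv (fun t => \prod_(k <- s) f k (env k t)).
    by apply: (@prod_bounded s (fun j t => f j (env j t))) => j js; exact/slice_fun_bounded/hf.
  have bX := future_bounded hX.
  under eq_fun do rewrite mulrCA.
  rewrite (ExZ P c (bounded_rvM bs bX)) (ExZ P c bX) (IHX s f us hs hf).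
  by rewrite mulrCA.
- have ss' k : k \in s' -> k \notin s.
    by move=> ks'; apply/negP => /hs; rewrite (hs' _ ks') ltxx.
  pose h k := if k \in s then f k else f' k.
  have hE t : \prod_(k <- s) f k (env k t) * (\prod_(k <- s') f' k (env k t) * X t) =
     \prod_(k <- s ++ s') h k (env k t) * X t.
    rewrite mulrA big_cat /=; congr (_ * _ * _); apply: eq_big_seq => k ks; rewrite /h ?ks//.
    by rewrite ifN// ss'.
  under eq_fun do rewrite hE.
  have lt1 : m%:Z < m.+1%:Z by rewrite ltz_nat.
  rewrite IHX.
  + rewrite IHX//; last by move=> k /hs' ->.
    rewrite big_cat /= mulrA; congr (_ * _ * _); apply: eq_big_seq => k ks; rewrite /h ?ks//.
    by rewrite ifN// ss'.
  + rewrite cat_uniq us us' andbT /=; apply/hasPn => k ks; exact: ss'.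
  + move=> k; rewrite mem_cat => /orP[/hs h1|/hs' ->//]; exact: lt_trans h1 lt1.
  + move=> k; rewrite mem_cat /h => /orP[ks|ks]; first by rewrite ks; exact: hf.
    by rewrite ifN ?ss'//; exact: hf'.
Qed.

End independence.

(** * Partition functions and their second moments *)

Section partition_function.
Context (R : realType) (d : nat) (dT : measure_display) (T : measurableType dT).
Context (P : probability T R) (omega : int -> 'rV[int]_d -> T -> step d -> R).
Context (momega : forall n x z, measurable_fun setT (fun t => omega n x t z)).
Context (omega0 : forall n x t z, 0 <= omega n x t z).
Context (omega1 : forall n x t, \sum_(z : step d) omega n x t z = 1).
Context (indep : env_independent P omega) (ident : env_identically_distributed P omega).
Local Notation E := (Ex P).
Implicit Types (e : step d -> R) (x y : 'rV[int]_d).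

Fixpoint partition e (L m : nat) x t : R :=
  if L is L'.+1
  then \sum_(z : step d) omega m%:Z x t z * e z * partition e L' m.+1 (x + stepvec z) t
  else 1.

Lemma omega_le1 n x t z : omega n x t z <= 1.
Proof. by rewrite -(omega1 n x t) (bigD1 z)//= lerDl sumr_ge0. Qed.

Lemma slice_fun_coord k z : slice_fun omega k (fun v => v z).
Proof.
split; [exact: cyl_measurable_coord|exact: momega|].
by move=> t; rewrite omega0 omega_le1.
Qed.

Lemma slice_fun_coord2 k z z' : slice_fun omega k (fun v => v z * v z').
Proof.
split; first by apply: cyl_measurableM; exact: cyl_measurable_coord.
  by apply: measurable_funM; exact: momega.
by move=> t; rewrite mulr_ge0 ?omega0//= mulr_ile1 ?omega0 ?omega_le1.
Qed.

(** Two replicas on the same site read the same random vector, so the pair must collapse to one key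
    before independence over distinct keys can be used. *)
Definition pair_keys (m : nat) x y : seq (env_key d) :=
  if x == y then [:: (m%:Z, x)] else [:: (m%:Z, x); (m%:Z, y)].

Definition pair_fun (m : nat) x y z z' (k : env_key d) (w : step d -> R) : R :=
  if x == y then w z * w z' else if k == (m%:Z, x) then w z else w z'.

Lemma pair_keys_uniq m x y : uniq (pair_keys m x y).
Proof.
rewrite /pair_keys; case: eqVneq => //= xy; rewrite inE andbT xpair_eqE negb_and.
by rewrite xy orbT.
Qed.

Lemma pair_keys_time m x y k : k \in pair_keys m x y -> k.1 = m%:Z.
Proof.
rewrite /pair_keys; case: ifP => _; rewrite !inE; first by move=> /eqP ->.
by case/orP => /eqP ->.
Qed.

Lemma pair_fun_slice m x y z z' k : slice_fun omega k (pair_fun m x y z z' k).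
Proof.
rewrite /pair_fun; case: eqP => _; first exact: slice_fun_coord2.
by case: eqP => _; exact: slice_fun_coord.
Qed.

Lemma pair_funE m x y z z' t :
  \prod_(k <- pair_keys m x y) pair_fun m x y z z' k (env omega k t) =
  omega m%:Z x t z * omega m%:Z y t z'.
Proof.
rewrite /pair_keys /pair_fun; case: eqVneq => [->|xy]; first by rewrite big_seq1.
by rewrite big_cons big_seq1 eqxx ifN// xpair_eqE eqxx eq_sym.
Qed.

Local Notation q := (qmean P omega).

Definition two_point z z' := E (fun t => omega 0 0 t z * omega 0 0 t z').

Lemma Ex_coord n x z : E (fun t => omega n x t z) = q z.
Proof. exact: (Ex_ident ident (slice_fun_coord (n, x) z) (slice_fun_coord (0, 0) z)). Qed.

Lemma Ex_pair_fun m x y z z' :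
  \prod_(k <- pair_keys m x y) E (fun t => pair_fun m x y z z' k (env omega k t)) =
  if x == y then two_point z z' else q z * q z'.
Proof.
rewrite /pair_keys /pair_fun; case: eqVneq => [->|xy].
  rewrite big_seq1.
  exact: (Ex_ident ident (slice_fun_coord2 (m%:Z, y) z z') (slice_fun_coord2 (0, 0) z z')).
have yx : ((m%:Z, y) == (m%:Z, x)) = false.
  by rewrite xpair_eqE eqxx eq_sym; apply/negbTE.
by rewrite big_cons big_seq1 eqxx yx !Ex_coord.
Qed.

Lemma partition2E e L m x y t :
  partition e L.+1 m x t * partition e L.+1 m y t =
  \sum_z \sum_z' (e z * e z') *
    (\prod_(k <- pair_keys m x y) pair_fun m x y z z' k (env omega k t) *
    (partition e L m.+1 (x + stepvec z) t * partition e L m.+1 (y + stepvec z') t)).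
Proof.
rewrite /= mulr_suml; apply: eq_bigr => z _; rewrite mulr_sumr; apply: eq_bigr => z' _.
by rewrite pair_funE; ring.
Qed.

Lemma future_partition2 e L m x y :
  future omega m (fun t => partition e L m x t * partition e L m y t).
Proof.
elim: L m x y => [|L IH] m x y; first exact: (@future_cst _ _ _ _ omega m (1 * 1)).
under eq_fun do rewrite partition2E.
apply: future_sum => z; apply: future_sum => z'; apply: futureZ.
apply: future_slice; [exact: pair_keys_uniq|exact: pair_keys_time| |exact: IH].
by move=> k _; exact: pair_fun_slice.
Qed.

Lemma future_partition e L m x : future omega m (partition e L m x).
Proof.
elim: L m x => [|L IH] m x; first exact: (@future_cst _ _ _ _ omega m 1).
have -> : partition e L.+1 m x = fun t => \sum_z e z * (\prod_(k <- [:: (m%:Z, x)])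
   (fun k (w : step d -> R) => w z) k (env omega k t) * partition e L m.+1 (x + stepvec z) t).
  by apply/funext => t /=; apply: eq_bigr => z _; rewrite big_seq1 mulrA (mulrC (e z)).
apply: future_sum => z; apply: futureZ.
apply: (@future_slice _ _ _ _ omega m [:: (m%:Z, x)] (fun k (w : step d -> R) => w z)) => //.
- by move=> k; rewrite inE => /eqP ->.
- by move=> k _; exact: slice_fun_coord.
Qed.

Lemma partition_bounded e L m x : bounded_rv (partition e L m x).
Proof. exact: future_bounded (future_partition e L m x). Qed.

Lemma Ex_partition e L m x : E (partition e L m x) = (\sum_z q z * e z) ^+ L.
Proof.
elim: L m x => [|L IH] m x; first exact: Ex_cst.
have -> : partition e L.+1 m x = fun t => \sum_z e z * (\prod_(k <- [:: (m%:Z, x)])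
   (fun k (w : step d -> R) => w z) k (env omega k t) * partition e L m.+1 (x + stepvec z) t).
  by apply/funext => t /=; apply: eq_bigr => z _; rewrite big_seq1 mulrA (mulrC (e z)).
have bb z : bounded_rv (fun t => \prod_(k <- [:: (m%:Z, x)])
   (fun k (w : step d -> R) => w z) k (env omega k t) * partition e L m.+1 (x + stepvec z) t).
  apply: bounded_rvM; last exact: partition_bounded.
  under eq_fun do rewrite big_seq1; exact: (slice_fun_bounded (slice_fun_coord (m%:Z, x) z)).
rewrite Ex_sum; last by move=> z; exact: bounded_rvZ.
rewrite exprS mulr_suml; apply: eq_bigr => z _.
rewrite ExZ//.
rewrite (@Ex_past_future _ _ _ _ _ _ indep m.+1 _ [:: (m%:Z, x)] (fun k (w : step d -> R) => w z))//.
- by rewrite big_seq1 IH Ex_coord; ring.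
- exact: future_partition.
- by move=> k; rewrite inE => /eqP ->; rewrite ltz_nat.
- by move=> k _; exact: slice_fun_coord.
Qed.

(* [psi] is a supersolution for the two-replica difference walk, whose weights
   at the origin are perturbed by the common environment. *)
Lemma second_moment e (psi : 'rV[int]_d -> R) :
  (forall z, 0 <= e z) -> \sum_z q z * e z = 1 -> (forall v, 0 <= psi v) ->
  (forall v, v != 0 -> \sum_z \sum_z' (q z * e z) * (q z' * e z') *
     psi (v + stepvec z - stepvec z') <= psi v) ->
  \sum_z \sum_z' two_point z z' * (e z * e z') * (1 + psi (stepvec z - stepvec z')) <= 1 + psi 0 ->
  forall L m x y, E (fun t => partition e L m x t * partition e L m y t) <= 1 + psi (x - y).
Proof.
move=> e0 e1 psi0 psi_off psi_on L; elim: L => [|L IH] m x y.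
  rewrite /= (_ : (fun=> 1 * 1) = (fun=> 1) :> (T -> R)) ?Ex_cst ?lerDl//.
  by apply/funext => t; rewrite mulr1.
under eq_fun do rewrite partition2E.
have bp : forall z z', bounded_rv (fun t =>
    \prod_(k <- pair_keys m x y) pair_fun m x y z z' k (env omega k t) *
    (partition e L m.+1 (x + stepvec z) t * partition e L m.+1 (y + stepvec z') t)).
  move=> z z'; apply: (@future_bounded _ _ _ _ omega m); apply: future_slice.
  - exact: pair_keys_uniq.
  - exact: pair_keys_time.
  - by move=> k _; exact: pair_fun_slice.
  - exact: future_partition2.
rewrite Ex_sum; last by move=> z; apply: bounded_rv_sum => z'; exact: bounded_rvZ.
have step1 : \sum_z E (fun t => \sum_z' e z * e z' *
    (\prod_(k <- pair_keys m x y) pair_fun m x y z z' k (env omega k t) *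
    (partition e L m.+1 (x + stepvec z) t * partition e L m.+1 (y + stepvec z') t))) <=
   \sum_z \sum_z' e z * e z' * ((if x == y then two_point z z' else q z * q z') *
     (1 + psi (x - y + stepvec z - stepvec z'))).
  apply: ler_sum => z _; rewrite Ex_sum; last by move=> z'; exact: bounded_rvZ.
  apply: ler_sum => z' _; rewrite ExZ// ler_wpM2l ?mulr_ge0//.
  rewrite (@Ex_past_future _ _ _ _ _ _ indep m.+1).
  + rewrite Ex_pair_fun ler_wpM2l//.
      case: ifP => _; first by apply: Ex_ge0 => t; rewrite mulr_ge0.
      by rewrite mulr_ge0// -(Ex_coord 0 0); apply: Ex_ge0.
    rewrite (_ : x - y + _ - _ = (x + stepvec z) - (y + stepvec z'))//.
    by rewrite opprD addrACA addrA.
  + exact: future_partition2.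
  + exact: pair_keys_uniq.
  + by move=> k /pair_keys_time ->; rewrite ltz_nat.
  + by move=> k _; exact: pair_fun_slice.
apply: le_trans step1 _.
(* At a collision the weights are the two-point ones and [psi_on] is exactly what is needed; off the
   diagonal the weights have total mass 1 and [psi_off] suffices. *)
have [->|xy] := eqVneq x y.
  rewrite subrr; apply: le_trans psi_on; rewrite le_eqVlt; apply/orP; left; apply/eqP.
  by apply: eq_bigr => z _; apply: eq_bigr => z' _; rewrite add0r; ring.
have h : \sum_z \sum_z' (q z * e z) * (q z' * e z') = 1.
  under eq_bigr do rewrite -mulr_sumr e1 mulr1.
  by rewrite e1.
have := psi_off (x - y); rewrite subr_eq0 => /(_ xy) h2.
apply: (@le_trans _ _ (\sum_z \sum_z' (q z * e z) * (q z' * e z') +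
  \sum_z \sum_z' (q z * e z) * (q z' * e z') * psi (x - y + stepvec z - stepvec z'))); last first.
  by rewrite h lerD.
rewrite -big_split /= le_eqVlt; apply/orP; left; apply/eqP.
by apply: eq_bigr => z _; rewrite -big_split /=; apply: eq_bigr => z' _; ring.
Qed.

End partition_function.

(** * A superharmonic function for the difference walk *)

Section fourth_root.
Context (R : realType).
Implicit Types (u y h : R).

(** This is y^(-1/4). In dimension 3 the continuum harmonic function |v|^(-1) corresponds to
    exponent -1/2 of a quadratic form; the weaker exponent leaves room for discretisation errors. *)
Definition inv_root4 y := (Num.sqrt (Num.sqrt y))^-1.

Lemma inv_root4_ge0 y : 0 <= inv_root4 y.
Proof. by rewrite invr_ge0 sqrtr_ge0. Qed.

Lemma inv_root4_le h y : 0 < h -> h ^+ 4 <= y -> inv_root4 y <= h^-1.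
Proof.
move=> h0 hy; have y0 : 0 < y by apply: lt_le_trans hy; rewrite exprn_gt0.
rewrite /inv_root4 lef_pV2 ?posrE ?sqrtr_gt0//.
rewrite -[leLHS]ger0_norm ?(ltW h0)// -sqrtr_sqr ler_sqrt ?sqrtr_gt0//.
rewrite -[leLHS]ger0_norm ?sqr_ge0// -sqrtr_sqr ler_sqrt; last exact: ltW.
by rewrite -exprM.
Qed.

Lemma inv_root4_decr y1 y2 : 0 < y1 -> y1 <= y2 -> inv_root4 y2 <= inv_root4 y1.
Proof.
move=> h1 h12; have h2 := lt_le_trans h1 h12.
by rewrite /inv_root4 lef_pV2 ?posrE ?sqrtr_gt0// !ler_wsqrtr.
Qed.

Lemma inv_root4_strict y1 y2 : 0 < y1 -> y1 < y2 -> inv_root4 y2 < inv_root4 y1.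
Proof.
move=> h1 h12; have h2 := lt_trans h1 h12.
by rewrite /inv_root4 ltf_pV2 ?posrE ?sqrtr_gt0// !ltr_sqrt ?sqrtr_gt0.
Qed.

(* [11/64] lies strictly between the Taylor coefficient [5/32] of [(1+u)^(-1/4)]
   and the value [3/16] that superharmonicity in dimension 3 tolerates. *)
Lemma root4_poly u : `|u| <= 1 / 32 ->
  1 <= (1 - u / 4 + 11 / 64 * u ^+ 2) ^+ 4 * (1 + u).
Proof.
rewrite ler_norml => /andP[u1 u2].
set t := 1 - u / 4 + 11 / 64 * u ^+ 2.
(* The coefficient of [u ^+ 2] in [t ^+ 2] is 26/64; giving up 1/64 of it absorbs the higher-order
   terms for |u| at most 1/32. *)
pose A := 1 - u / 2 + 25 / 64 * u ^+ 2.
have u20 : 0 <= u ^+ 2 by exact: sqr_ge0.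
have A0 : 0 <= A by rewrite /A; lra.
have tA : A <= t ^+ 2.
  rewrite -subr_ge0.
  have -> : t ^+ 2 - A = u ^+ 2 * (1 / 64 - 11 / 128 * u + (11 / 64 * u) ^+ 2) by rewrite /t /A; field.
  apply: mulr_ge0 => //; have := sqr_ge0 (11 / 64 * u); lra.
have AA : 1 - u + 66 / 64 * u ^+ 2 - 25 / 64 * (u ^+ 2 * u) <= A ^+ 2.
  rewrite -subr_ge0.
  have -> : A ^+ 2 - (1 - u + 66 / 64 * u ^+ 2 - 25 / 64 * (u ^+ 2 * u)) = (25 / 64 * u ^+ 2) ^+ 2.
    by rewrite /A; field.
  exact: sqr_ge0.
have tt : A ^+ 2 <= t ^+ 4 by rewrite -[t ^+ 4]/(t ^+ (2 * 2)) exprM lerXn2r ?nnegrE ?sqr_ge0.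
apply: (@le_trans _ _ ((1 - u + 66 / 64 * u ^+ 2 - 25 / 64 * (u ^+ 2 * u)) * (1 + u))); last first.
  by rewrite ler_wpM2r ?(le_trans AA)//; lra.
rewrite -subr_ge0.
have -> : (1 - u + 66 / 64 * u ^+ 2 - 25 / 64 * (u ^+ 2 * u)) * (1 + u) - 1 =
   u ^+ 2 * (1 / 32 + 41 / 64 * u - 25 / 64 * u ^+ 2) by field.
apply: mulr_ge0 => //.
have : u ^+ 2 <= 1 / 32 * (1 / 32) by rewrite expr2; nra.
lra.
Qed.

Lemma inv_root4_taylor y u : 0 < y -> `|u| <= 1 / 32 ->
  inv_root4 (y * (1 + u)) <= inv_root4 y * (1 - u / 4 + 11 / 64 * u ^+ 2).
Proof.
move=> y0 hu; have p4 := root4_poly hu.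
have /andP[u1 u2] : - (1 / 32) <= u <= 1 / 32 by rewrite -ler_norml.
set t := 1 - u / 4 + 11 / 64 * u ^+ 2 in p4 *.
have t0 : 0 < t by rewrite /t; nra.
rewrite /inv_root4 (sqrtrM _ (ltW y0)) (sqrtrM _ (sqrtr_ge0 y)) invfM.
rewrite ler_wpM2l ?invr_ge0 ?sqrtr_ge0//.
rewrite -[leRHS]invrK; apply: inv_root4_le; first by rewrite invr_gt0.
by rewrite exprVn -[leLHS]mul1r ler_pdivrMr ?exprn_gt0// mulrC.
Qed.

End fourth_root.

(** * Covariance form of the tilted step and its moments *)

Lemma step_sum (V : nmodType) d (F : step d -> V) :
  \sum_z F z = \sum_i (F (i, true) + F (i, false)).
Proof.
rewrite (eq_bigr (fun z => F (z.1, z.2))); last by case.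
rewrite -(pair_bigA _ (fun i b => F (i, b))) /=; apply: eq_bigr => i _.
by rewrite big_bool.
Qed.

Section difference_walk.
Context (R : realType) (d : nat) (p : step d -> R) (c : R).
Context (d3 : (3 <= d)%N) (c0 : 0 < c) (pc : forall z, c <= p z) (p1 : \sum_z p z = 1).
Implicit Types u w : 'I_d -> R.

(** A step has mean [m] and second moment matrix diag [D], hence covariance Sigma = diag D - m m^T;
    [rho] is <m, D^-1 m> and [s] the Sherman-Morrison factor. *)
Let D i := p (i, true) + p (i, false).
Let m i := p (i, true) - p (i, false).
Let rho := \sum_i m i ^+ 2 / D i.
Let s := (1 - rho)^-1.

Definition stepc (z : step d) i : R := (if z.2 then 1 else -1) * (i == z.1)%:R.

Let p_gt0 z : 0 < p z. Proof. exact: lt_le_trans (pc z). Qed.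
Let pp_ge0 z z' : 0 <= p z * p z'. Proof. by rewrite mulr_ge0// ltW. Qed.
Let D_gt0 i : 0 < D i. Proof. exact: addr_gt0. Qed.
Let D_neq0 i : D i != 0. Proof. by rewrite gt_eqF. Qed.
Let D_sum : \sum_i D i = 1. Proof. by rewrite -p1 step_sum. Qed.

Let D_le1 i : D i <= 1.
Proof. by rewrite -D_sum (bigD1 i)//= lerDl sumr_ge0// => j _; exact/ltW. Qed.

Let m_le i : `|m i| <= D i.
Proof. by rewrite ler_norml /m /D; have := p_gt0 (i, true); have := p_gt0 (i, false); lra. Qed.

(** From D^2 - m^2 = 4 p(+) p(-) in each direction. Ellipticity thus keeps [rho] away from 1, which
    makes Sigma invertible with quantitative control. *)
Let rhoE : 1 - rho = \sum_i 4 * (p (i, true) * p (i, false)) / D i.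
Proof.
rewrite -[X in X - _]D_sum -sumrB; apply: eq_bigr => i _.
have := D_neq0 i; rewrite /m /D => h; by field.
Qed.

Let rho_ge : 4 * c ^+ 2 <= 1 - rho.
Proof.
rewrite rhoE; have i0 : 'I_d by apply: (Ordinal (n := d) (m := 0)); lia.
rewrite (bigD1 i0)//=; apply: ler_wpDr.
  by apply: sumr_ge0 => i _; rewrite divr_ge0 ?mulr_ge0// ltW.
rewrite ler_pdivlMr//; apply: (@le_trans _ _ (4 * c ^+ 2)).
  by rewrite ler_piMr// mulr_ge0// sqr_ge0.
by rewrite ler_wpM2l// expr2 ler_pM// ltW.
Qed.

Let rho_lt : 0 < 1 - rho.
Proof. by apply: lt_le_trans rho_ge; rewrite mulr_gt0// exprn_gt0. Qed.

Let s_gt0 : 0 < s. Proof. by rewrite invr_gt0. Qed.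

Let s_rho : s * rho = s - 1.
Proof. by rewrite /s; have := gt_eqF rho_lt; move/negbT => h; field. Qed.

Definition drift_form u := \sum_i m i * u i / D i.

(* The inverse of the covariance matrix [diag D - m m^T] of one step, by the
   Sherman-Morrison formula. *)
Definition cov_form u w := \sum_i u i * w i / D i + s * (drift_form u * drift_form w).

Let drift_formZD a b u w :
  drift_form (fun i => a * u i + b * w i) = a * drift_form u + b * drift_form w.
Proof. by rewrite /drift_form !mulr_sumr -big_split; apply: eq_bigr => i _ /=; ring. Qed.

Lemma cov_formZDr a b u w w' :
  cov_form u (fun i => a * w i + b * w' i) = a * cov_form u w + b * cov_form u w'.
Proof.
rewrite /cov_form drift_formZD.
rewrite [X in X + _ = _](_ : _ = a * \sum_i u i * w i / D i + b * \sum_i u i * w' i / D i).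
  by ring.
by rewrite !mulr_sumr -big_split; apply: eq_bigr => i _ /=; ring.
Qed.

Lemma cov_formC u w : cov_form u w = cov_form w u.
Proof.
rewrite /cov_form (mulrC (drift_form u)); congr (_ + _).
by apply: eq_bigr => i _; rewrite (mulrC (u i)).
Qed.

Lemma cov_form_sqr a b u w :
  cov_form (fun i => a * u i + b * w i) (fun i => a * u i + b * w i) =
  a ^+ 2 * cov_form u u + 2 * (a * b) * cov_form u w + b ^+ 2 * cov_form w w.
Proof.
have h v : cov_form (fun i => a * u i + b * w i) v = a * cov_form u v + b * cov_form w v.
  by rewrite cov_formC cov_formZDr !(cov_formC v).
rewrite cov_formZDr !h (cov_formC w u); ring.
Qed.

(** The Sherman-Morrison term is a square and [D i <= 1]. This lower bound yields both the decay of
    psi and its strict drop away from the origin. *)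
Lemma cov_form_ge u i : u i ^+ 2 <= cov_form u u.
Proof.
apply: ler_wpDr; first by rewrite mulr_ge0 ?(ltW s_gt0)// -expr2 sqr_ge0.
rewrite (bigD1 i)//=; apply: ler_wpDr.
  by apply: sumr_ge0 => j _; rewrite -expr2 divr_ge0 ?sqr_ge0// ltW.
by rewrite -expr2 ler_pdivlMr// ler_piMr ?sqr_ge0.
Qed.

Lemma cov_form_ge0 u : 0 <= cov_form u u.
Proof.
apply: addr_ge0; last by rewrite mulr_ge0 ?(ltW s_gt0)// -expr2 sqr_ge0.
by apply: sumr_ge0 => i _; rewrite -expr2 divr_ge0 ?sqr_ge0// ltW.
Qed.

Let sum_stepc (F : 'I_d -> R) z : \sum_i F i * stepc z i = F z.1 * (if z.2 then 1 else -1).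
Proof.
rewrite (bigD1 z.1)//= /stepc eqxx mulr1 big1 ?addr0// => i iz.
by rewrite (negbTE iz) !mulr0.
Qed.

(** The i-th coordinate of Sigma^-1 u: pairing [u] with a unit step reads it off up to sign. *)
Let grad u i := u i / D i + s * drift_form u * m i / D i.

Let drift_stepc z : drift_form (stepc z) = m z.1 / D z.1 * (if z.2 then 1 else -1).
Proof.
by rewrite -(sum_stepc (fun i => m i / D i)); apply: eq_bigr => i _; rewrite mulrAC.
Qed.

Let cov_stepc u z : cov_form u (stepc z) = grad u z.1 * (if z.2 then 1 else -1).
Proof.
rewrite /cov_form drift_stepc /grad [RHS]mulrDl; congr (_ + _); last by ring.
by rewrite -(sum_stepc (fun i => u i / D i)); apply: eq_bigr => i _; rewrite mulrAC.
Qed.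

Let mean_cov_step u : \sum_z p z * cov_form u (stepc z) = s * drift_form u.
Proof.
rewrite step_sum.
transitivity (\sum_i (m i * u i / D i + s * drift_form u * (m i ^+ 2 / D i))).
  by apply: eq_bigr => i _; rewrite !cov_stepc /= /grad /m; ring.
rewrite big_split /= -mulr_sumr -/rho -/(drift_form u).
by have := s_rho; move=> h; rewrite mulrAC h; ring.
Qed.

(** The second moment matrix is Sigma + m m^T: the first part gives the form itself, the second the
    square of the mean found in [mean_cov_step]. *)
Let mean_cov_step2 u : \sum_z p z * cov_form u (stepc z) ^+ 2 =
  cov_form u u + s ^+ 2 * drift_form u ^+ 2.
Proof.
rewrite step_sum.
transitivity (\sum_i (u i * u i / D i + 2 * s * drift_form u * (m i * u i / D i) +
    s ^+ 2 * drift_form u ^+ 2 * (m i ^+ 2 / D i))).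
  apply: eq_bigr => i _; rewrite !cov_stepc /= /grad.
  rewrite mulrN1 sqrrN mulr1 -mulrDl -/(D i).
  by field; exact: D_neq0.
rewrite !big_split /= -!mulr_sumr -/rho -/(drift_form u) /cov_form.
have -> : s ^+ 2 * drift_form u ^+ 2 * rho = s * drift_form u ^+ 2 * (s * rho) by ring.
by rewrite s_rho; ring.
Qed.

(** The trace of Sigma^-1 (Sigma + m m^T); the surplus <m, Sigma^-1 m> = [s * rho] is cancelled by
    the cross term in the difference of two steps. *)
Let mean_cov_stepstep : \sum_z p z * cov_form (stepc z) (stepc z) = d%:R + s * rho.
Proof.
rewrite step_sum.
transitivity (\sum_(i < d) (1 + s * (m i ^+ 2 / D i))).
  apply: eq_bigr => i _; rewrite !cov_stepc /= /grad !drift_stepc /stepc /= eqxx !mulr1.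
  by have := D_neq0 i; rewrite /m /D => h; field.
by rewrite big_split /= -mulr_sumr sumr_const card_ord.
Qed.

Let mean_cov_cross : \sum_z \sum_z' p z * p z' * cov_form (stepc z) (stepc z') = s * rho.
Proof.
transitivity (\sum_z p z * (s * drift_form (stepc z))).
  by apply: eq_bigr => z _; rewrite -mean_cov_step mulr_sumr; apply: eq_bigr => z' _; ring.
rewrite step_sum /rho mulr_sumr; apply: eq_bigr => i _.
by rewrite !drift_stepc /= /m; ring.
Qed.

(** The difference of two independent steps is centred with covariance 2 Sigma. This explains the
    values 0, 2 <u, Sigma^-1 u> and 2 d of the moments computed from it. *)
Let disp z z' i := stepc z i - stepc z' i.

Let cov_disp u z z' : cov_form u (disp z z') = cov_form u (stepc z) - cov_form u (stepc z').
Proof.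
have -> : disp z z' = fun i => 1 * stepc z i + (- 1) * stepc z' i.
  by apply/funext => i; rewrite /disp; ring.
by rewrite cov_formZDr; ring.
Qed.

Let cov_dispdisp z z' : cov_form (disp z z') (disp z z') = cov_form (stepc z) (stepc z) +
  cov_form (stepc z') (stepc z') - 2 * cov_form (stepc z) (stepc z').
Proof.
have -> : disp z z' = fun i => 1 * stepc z i + (- 1) * stepc z' i.
  by apply/funext => i; rewrite /disp; ring.
by rewrite cov_form_sqr; ring.
Qed.

Let pair_sum1 : \sum_z \sum_z' p z * p z' = 1.
Proof. by under eq_bigr do rewrite -mulr_sumr p1 mulr1; rewrite p1. Qed.

Let pair_suml (F : step d -> R) : \sum_z \sum_z' p z * p z' * F z = \sum_z p z * F z.
Proof.
apply: eq_bigr => z _; transitivity (\sum_z' p z' * (p z * F z)).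
  by apply: eq_bigr => z' _; ring.
by rewrite -mulr_suml p1 mul1r.
Qed.

Let pair_sumr (F : step d -> R) : \sum_z \sum_z' p z * p z' * F z' = \sum_z p z * F z.
Proof.
rewrite exchange_big /= -[RHS]pair_suml; apply: eq_bigr => z _; apply: eq_bigr => z' _; ring.
Qed.

Let mean_disp u : \sum_z \sum_z' p z * p z' * cov_form u (disp z z') = 0.
Proof.
transitivity (\sum_z \sum_z' p z * p z' * cov_form u (stepc z) -
  \sum_z \sum_z' p z * p z' * cov_form u (stepc z')); last first.
  by rewrite pair_suml pair_sumr subrr.
rewrite -sumrB; apply: eq_bigr => z _; rewrite -sumrB; apply: eq_bigr => z' _; rewrite cov_disp; ring.
Qed.

Let mean_disp2 u : \sum_z \sum_z' p z * p z' * cov_form u (disp z z') ^+ 2 = 2 * cov_form u u.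
Proof.
transitivity (\sum_z \sum_z' p z * p z' * cov_form u (stepc z) ^+ 2 +
   \sum_z \sum_z' p z * p z' * cov_form u (stepc z') ^+ 2 -
   2 * ((\sum_z p z * cov_form u (stepc z)) * (\sum_z p z * cov_form u (stepc z)))); last first.
  by rewrite pair_suml pair_sumr mean_cov_step mean_cov_step2; ring.
rewrite -big_split /= big_distrlr /= mulr_sumr -sumrB; apply: eq_bigr => z _.
rewrite -big_split /= mulr_sumr -sumrB; apply: eq_bigr => z' _.
rewrite cov_disp; ring.
Qed.

Let mean_dispdisp : \sum_z \sum_z' p z * p z' * cov_form (disp z z') (disp z z') = 2 * d%:R.
Proof.
transitivity (\sum_z \sum_z' p z * p z' * cov_form (stepc z) (stepc z) +
   \sum_z \sum_z' p z * p z' * cov_form (stepc z') (stepc z') -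
   2 * \sum_z \sum_z' p z * p z' * cov_form (stepc z) (stepc z')); last first.
  rewrite (pair_suml (fun z => cov_form (stepc z) (stepc z))).
  rewrite (pair_sumr (fun z => cov_form (stepc z) (stepc z))).
  by rewrite mean_cov_stepstep mean_cov_cross; ring.
rewrite -big_split /= mulr_sumr -sumrB; apply: eq_bigr => z _.
rewrite -big_split /= !mulr_sumr -sumrB; apply: eq_bigr => z' _.
rewrite cov_dispdisp; ring.
Qed.

(** Exchanging the two steps reverses the displacement, so odd moments vanish. *)
Let mean_disp_cubic u :
  \sum_z \sum_z' p z * p z' * (cov_form u (disp z z') * cov_form (disp z z') (disp z z')) = 0.
Proof.
set S := LHS; suff : S = - S by lra.
rewrite {1}/S exchange_big /= /S -sumrN; apply: eq_bigr => z _; rewrite -sumrN.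
apply: eq_bigr => z' _; rewrite !cov_dispdisp !cov_disp (cov_formC (stepc z')); ring.
Qed.

(** One step has form 1/D + s (m/D)^2, where D >= 2c, s <= 1/(4 c^2) and |m/D| <= 1; the factor 4
    comes from the parallelogram bound for the difference of two steps. *)
Definition cov_bound := 4 * ((2 * c)^-1 + (4 * c ^+ 2)^-1).

Let cov_stepstep_le z : cov_form (stepc z) (stepc z) <= (2 * c)^-1 + (4 * c ^+ 2)^-1.
Proof.
rewrite cov_stepc /grad drift_stepc.
have -> : (stepc z z.1 / D z.1 + s * (m z.1 / D z.1 * (if z.2 then 1 else -1)) * m z.1 / D z.1) *
    (if z.2 then 1 else -1) = (D z.1)^-1 + s * (m z.1 / D z.1) ^+ 2.
  by have h := D_neq0 z.1; rewrite /stepc eqxx mulr1; case: z.2 => /=; field.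
have c20 : 0 < 4 * c ^+ 2 by rewrite mulr_gt0// exprn_gt0.
apply: lerD.
  rewrite lef_pV2 ?posrE//; last by rewrite mulr_gt0.
  by rewrite /D; have := pc (z.1, true); have := pc (z.1, false); lra.
rewrite -[leRHS]mulr1; apply: ler_pM => //; first exact: ltW.
- exact: sqr_ge0.
- by rewrite /s lef_pV2 ?posrE.
- rewrite -real_normK ?num_real// exprn_ile1// normrM normrV ?unitfE// (gtr0_norm (D_gt0 _)).
  by rewrite ler_pdivrMr// mul1r.
Qed.

Let cov_bound_gt0 : 0 < cov_bound.
Proof. by rewrite mulr_gt0// addr_gt0// invr_gt0 mulr_gt0// exprn_gt0. Qed.

Let cov_dispdisp_le z z' : cov_form (disp z z') (disp z z') <= cov_bound.
Proof.
have := cov_form_ge0 (fun i => 1 * stepc z i + 1 * stepc z' i).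
rewrite cov_form_sqr cov_dispdisp.
have := cov_stepstep_le z; have := cov_stepstep_le z'; rewrite /cov_bound; lra.
Qed.

(** Here 1056 = 32 * 33 forces the relative increment below 1/32, the square dominates the quartic
    error term, and 1 ensures that psi is at most 1. *)
Definition offset := 1056 * cov_bound + cov_bound ^+ 2 + 1.

(** With y = offset + r and r the form at [u], the increment has mean 2d and second moment at most
    8r + [cov_bound ^+ 2]. In the Taylor bound the gain is 2d/(4y), at least (3/2)/y, against a loss
    whose leading part is (11/64) 8r/y^2, at most (11/8)/y: this is where d >= 3 enters. *)
Lemma superharmonic u :
  \sum_z \sum_z' p z * p z' *
    inv_root4 (offset + cov_form (fun i => u i + (stepc z i - stepc z' i))
                                 (fun i => u i + (stepc z i - stepc z' i))) <=
  inv_root4 (offset + cov_form u u).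
Proof.
set r := cov_form u u; have r0 : 0 <= r by exact: cov_form_ge0.
set y := offset + r.
have b0 := cov_bound_gt0; have b2 : 0 <= cov_bound ^+ 2 by exact: sqr_ge0.
have y0 : 0 < y by rewrite /y /offset; lra.
pose inc z z' := 2 * cov_form u (disp z z') + cov_form (disp z z') (disp z z').
have incE z z' : offset + cov_form (fun i => u i + (stepc z i - stepc z' i))
    (fun i => u i + (stepc z i - stepc z' i)) = y * (1 + inc z z' / y).
  have -> : (fun i => u i + (stepc z i - stepc z' i)) = fun i => 1 * u i + 1 * disp z z' i.
    by apply/funext => i; rewrite /disp; ring.
  have -> : y * (1 + inc z z' / y) = y + inc z z' by field; rewrite gt_eqF.
  by rewrite cov_form_sqr /y /r /inc; ring.
have inc_small z z' : `|inc z z' / y| <= 1 / 32.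
  rewrite normrM normrV ?unitfE ?gt_eqF// (gtr0_norm y0) ler_pdivrMr//.
  (* Young's inequality with weight 1/32: twice the cross term is at most r/32 + 32 times the form
     of the displacement. *)
  have h1 := cov_form_ge0 (fun i => 1 / 32 * u i + 1 * disp z z' i).
  have h2 := cov_form_ge0 (fun i => 1 / 32 * u i + (- 1) * disp z z' i).
  have h3 := cov_dispdisp_le z z'; have h4 := cov_form_ge0 (disp z z').
  move: h1 h2; rewrite !cov_form_sqr -/r /inc => h1 h2.
  by rewrite ler_norml /y /offset; lra.
apply: (@le_trans _ _ (\sum_z \sum_z' p z * p z' * (inv_root4 y *
    (1 - (inc z z' / y) / 4 + 11 / 64 * (inc z z' / y) ^+ 2)))).
  apply: ler_sum => z _; apply: ler_sum => z' _; rewrite ler_wpM2l ?pp_ge0//.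
  by rewrite incE; exact: inv_root4_taylor.
have sum_inc : \sum_z \sum_z' p z * p z' * inc z z' = 2 * d%:R.
  transitivity (2 * \sum_z \sum_z' p z * p z' * cov_form u (disp z z') +
    \sum_z \sum_z' p z * p z' * cov_form (disp z z') (disp z z')); last first.
    by rewrite mean_disp mean_dispdisp mulr0 add0r.
  rewrite mulr_sumr -big_split; apply: eq_bigr => z _; rewrite mulr_sumr -big_split.
  by apply: eq_bigr => z' _; rewrite /inc /=; ring.
have sum_inc2 : \sum_z \sum_z' p z * p z' * inc z z' ^+ 2 <= 8 * r + cov_bound ^+ 2.
  have -> : \sum_z \sum_z' p z * p z' * inc z z' ^+ 2 = 8 * r + \sum_z \sum_z' p z * p z' *
      cov_form (disp z z') (disp z z') ^+ 2.
    transitivity (4 * (\sum_z \sum_z' p z * p z' * cov_form u (disp z z') ^+ 2) +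
      4 * (\sum_z \sum_z' p z * p z' * (cov_form u (disp z z') * cov_form (disp z z') (disp z z'))) +
      \sum_z \sum_z' p z * p z' * cov_form (disp z z') (disp z z') ^+ 2); last first.
      by rewrite mean_disp2 mean_disp_cubic -/r; ring.
    rewrite !mulr_sumr -!big_split.
    apply: eq_bigr => z _; rewrite /= !mulr_sumr -!big_split.
    by apply: eq_bigr => z' _; rewrite /inc /=; ring.
  rewrite lerD2l -[leRHS]mul1r -pair_sum1 mulr_suml; apply: ler_sum => z _.
  rewrite mulr_suml; apply: ler_sum => z' _; rewrite ler_wpM2l ?pp_ge0//.
  by rewrite lerXn2r ?nnegrE ?cov_form_ge0 ?cov_dispdisp_le ?ltW.
have -> : \sum_z \sum_z' p z * p z' * (inv_root4 y *
    (1 - (inc z z' / y) / 4 + 11 / 64 * (inc z z' / y) ^+ 2)) =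
    inv_root4 y * (\sum_z \sum_z' p z * p z' - (\sum_z \sum_z' p z * p z' * inc z z') / y / 4 +
      11 / 64 * (\sum_z \sum_z' p z * p z' * inc z z' ^+ 2) / y ^+ 2).
  have -> (A B C : R) : inv_root4 y * (A - B / y / 4 + 11 / 64 * C / y ^+ 2) =
     inv_root4 y * A + (- inv_root4 y / y / 4) * B + (inv_root4 y * (11 / 64) / y ^+ 2) * C.
    by field; rewrite gt_eqF.
  rewrite !mulr_sumr -!big_split; apply: eq_bigr => z _; rewrite /= !mulr_sumr -!big_split.
  by apply: eq_bigr => z' _ /=; field; rewrite gt_eqF.
rewrite pair_sum1 sum_inc -[leRHS]mulr1 ler_wpM2l ?inv_root4_ge0//.
have d3' : 3 <= d%:R :> R by rewrite ler_nat.
suff : 11 / 64 * (\sum_z \sum_z' p z * p z' * inc z z' ^+ 2) / y ^+ 2 <= 2 * d%:R / y / 4 by lra.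
set S := \sum_z _ in sum_inc2 *.
have -> : 11 / 64 * S / y ^+ 2 = (11 / 64 * S / y) / y by field; rewrite gt_eqF.
have -> : 2 * d%:R / y / 4 = (d%:R / 2) / y by field; rewrite gt_eqF.
rewrite ler_wpM2r ?invr_ge0 ?(ltW y0)// ler_pdivrMr//.
have : 3 * y <= d%:R * y by rewrite ler_wpM2r// ltW.
by move: sum_inc2; rewrite /y /offset; lra.
Qed.

End difference_walk.

(** * The replica bound for small tilts *)

Section small_tilt.
Context (R : realType) (d : nat) (dT : measure_display) (T : measurableType dT).
Context (P : probability T R) (omega : int -> 'rV[int]_d -> T -> step d -> R) (c1 : R).
Context (d3 : (3 <= d)%N).
Context (momega : forall n x z, measurable_fun setT (fun t => omega n x t z)).
Context (omega0 : forall n x t z, 0 <= omega n x t z).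
Context (omega1 : forall n x t, \sum_(z : step d) omega n x t z = 1).
Context (indep : env_independent P omega) (ident : env_identically_distributed P omega).
Context (c10 : 0 < c1) (elliptic : forall z, P [set t | c1 <= omega 0 0 t z] = 1%E).
Local Notation E := (Ex P).
Local Notation q := (qmean P omega).

Let bcoord n x z : bounded_rv (fun t => omega n x t z).
Proof. exact: (slice_fun_bounded (slice_fun_coord momega omega0 omega1 (n, x) z)). Qed.

(** [le_Ex] compares pointwise while ellipticity holds almost surely; multiplying by the indicator
    of an event of probability 1 reconciles the two. *)
Let ind z t : R := \1_[set t | c1 <= omega 0 0 t z] t.

Let bind z : bounded_rv (ind z).
Proof.
exact/bounded_rv_indic/measurable_superlevel/momega.
Qed.

Let Ex_ind z : E (ind z) = 1.
Proof.
have mA : measurable [set t | c1 <= omega 0 0 t z].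
  exact/measurable_superlevel/momega.
by apply: EFin_inj; rewrite (Ex_indic P mA) elliptic.
Qed.

Let indP z t : ind z t = 1 /\ c1 <= omega 0 0 t z \/ ind z t = 0.
Proof.
rewrite /ind indicE; case: (boolP (t \in _)) => [|_]; last by right.
by rewrite inE /=; left.
Qed.

Lemma qmean_ge z : c1 <= q z.
Proof.
have -> : c1 = E (fun t => c1 * ind z t) by rewrite ExZ// Ex_ind mulr1.
apply: le_Ex => //; first exact: bounded_rvZ.
by move=> t; have [[-> h]|->] := indP z t; rewrite ?mulr1 ?mulr0.
Qed.

Lemma qmean_sum : \sum_z q z = 1.
Proof.
rewrite -(Ex_cst P 1) -(Ex_sum P (index_enum _) (bcoord 0 0)); congr Ex.
by apply/funext => t; rewrite omega1.
Qed.

Let b2 z z' : bounded_rv (fun t => omega 0 0 t z * omega 0 0 t z').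
Proof. exact: bounded_rvM. Qed.

Lemma two_point_ge z z' : c1 ^+ 2 <= two_point P omega z z'.
Proof.
(* The sum of the two indicators minus 1 is a lower bound for the indicator of the intersection, and
   its mean is 1. *)
have -> : c1 ^+ 2 = E (fun t => c1 ^+ 2 * (ind z t + (ind z' t + (- 1)))).
  rewrite ExZ; last by do 2![apply: bounded_rvD => //]; exact: bounded_rv_cst.
  rewrite ExD//; last by apply: bounded_rvD => //; exact: bounded_rv_cst.
  by rewrite ExD//; [rewrite !Ex_ind Ex_cst; ring|exact: bounded_rv_cst].
apply: le_Ex => //.
  by apply: bounded_rvZ; do 2![apply: bounded_rvD => //]; exact: bounded_rv_cst.
move=> t; have c2 : 0 <= c1 ^+ 2 by exact: sqr_ge0.
have ww : 0 <= omega 0 0 t z * omega 0 0 t z' by exact: mulr_ge0.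
have [[-> h]|->] := indP z t; have [[-> h']|->] := indP z' t; try by (nra || lra).
rewrite addrN addr0 mulr1 expr2; apply: ler_pM => //; exact: ltW.
Qed.

Lemma two_point_sum : \sum_z \sum_z' two_point P omega z z' = 1.
Proof.
under eq_bigr do rewrite -(Ex_sum P (index_enum _) (b2 _)).
rewrite -(Ex_sum P); last by move=> z; exact: bounded_rv_sum.
rewrite -[RHS](Ex_cst P 1); congr Ex; apply/funext => t.
by under eq_bigr do rewrite -mulr_sumr omega1 mulr1; rewrite omega1.
Qed.

(** One ellipticity constant for all admissible tilted walks, since 2 tau <= 1. It fixes [a] and
    [gap] before [tau] is chosen, which avoids circularity. *)
Let c := c1 * expR (- 1).

Let c_gt0 : 0 < c. Proof. by rewrite mulr_gt0// expR_gt0. Qed.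

Let a : R := offset c.

Let a_ge1 : 1 <= a.
Proof.
have h : 0 < cov_bound c by rewrite mulr_gt0// addr_gt0// invr_gt0 mulr_gt0// exprn_gt0.
rewrite /a /offset lerDr; apply: addr_ge0; last exact: sqr_ge0.
by apply: mulr_ge0; [exact: ler0n|exact: ltW].
Qed.

Let a_gt0 : 0 < a. Proof. exact: lt_le_trans a_ge1. Qed.

Let gap := inv_root4 a - inv_root4 (a + 1).

Let gap_gt0 : 0 < gap.
Proof. by rewrite subr_gt0; apply: inv_root4_strict => //; rewrite ltrDl. Qed.

Definition coords (v : 'rV[int]_d) i : R := (v 0 i)%:~R.

Lemma coords_stepvec z i : coords (stepvec z) i = stepc R z i.
Proof.
rewrite /coords /stepvec /stepc mxE mxE eqxx /=.
by case: z.2; case: (i == z.1); rewrite ?mulr1 ?mulr0 ?mulN1r.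
Qed.

Lemma coords_disp v z z' i :
  coords (v + stepvec z - stepvec z') i = coords v i + (stepc R z i - stepc R z' i).
Proof. by rewrite -!coords_stepvec /coords !mxE !rmorphD rmorphN /= addrA. Qed.

(* [(1 + delta)] is the total weight of the difference walk at the origin;
   it exceeds 1 by less than the loss caused by the strict maximum of [psi]. *)
Lemma replica_bound : exists tau : R, [/\ 0 < tau, tau <= 1 / 2 &
  forall e, (forall z, expR (- (2 * tau)) <= e z <= expR (2 * tau)) -> \sum_z q z * e z = 1 ->
  exists psi : 'rV[int]_d -> R, [/\ forall v, 0 <= psi v <= 1,
    forall v i h, 0 < h -> h ^+ 4 <= coords v i ^+ 2 -> psi v <= h^-1 &
    forall L m x y,
      E (fun t => partition omega e L m x t * partition omega e L m y t) <= 1 + psi (x - y)]].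
Proof.
pose K := c1 ^+ 2 * expR (- 2) * gap.
have K0 : 0 < K by rewrite !mulr_gt0// ?exprn_gt0// expR_gt0.
(* For tau <= 1/8, the inequality 1 - 4 tau <= e^(-4 tau) gives e^(4 tau) <= 1 + 8 tau. The excess
   mass then costs at most (1 + psi 0) * 8 tau <= 16 tau, which the drop [K] must cover. *)
exists (Num.min (1 / 8) (K / 16)); set tau := Num.min _ _.
have tau0 : 0 < tau by rewrite lt_min; apply/andP; split; lra.
have tau8 : tau <= 1 / 8 by rewrite ge_min lexx.
have tauK : 16 * tau <= K.
  have : tau <= K / 16 by rewrite ge_min lexx orbT.
  lra.
split => //; first lra.
move=> e he e1.
have e0 z : 0 <= e z by have /andP[h _] := he z; apply: le_trans h; exact: expR_ge0.
pose p z := q z * e z.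
have pc z : c <= p z.
  have /andP[h _] := he z; apply: ler_pM; rewrite ?expR_ge0 ?(ltW c10) ?qmean_ge//.
  by apply: le_trans h; rewrite ler_expR; lra.
pose psi v := inv_root4 (a + cov_form p (coords v) (coords v)).
have cov0 v : 0 <= cov_form p (coords v) (coords v) by exact: (cov_form_ge0 d3 c_gt0 pc e1).
have psi0 v : 0 <= psi v by exact: inv_root4_ge0.
have psi_le v : psi v <= inv_root4 a.
  by apply: inv_root4_decr => //; rewrite lerDl.
have root_a : inv_root4 a <= 1.
  by rewrite -[leRHS]invr1; apply: inv_root4_le => //; rewrite expr1n.
exists psi; split.
- by move=> v; rewrite psi0 (le_trans (psi_le v)).
- move=> v i h h0 hv; apply: inv_root4_le => //; apply: le_trans hv _.
  apply: le_trans (cov_form_ge d3 c_gt0 pc e1 (coords v) i) _.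
  by rewrite lerDr ltW.
- apply: second_moment => //.
  + move=> v _; have := superharmonic d3 c_gt0 pc e1 (coords v); apply: le_trans.
    rewrite le_eqVlt; apply/orP; left; apply/eqP.
    apply: eq_bigr => z _; apply: eq_bigr => z' _; congr (_ * inv_root4 (_ + _)).
    by congr (cov_form _ _ _); apply/funext => i; rewrite coords_disp.
  + have psi00 : psi 0 = inv_root4 a.
      rewrite /psi; congr inv_root4.
      rewrite (_ : coords 0 = fun=> 0); last by apply/funext => i; rewrite /coords mxE.
      have -> : (fun=> 0) = (fun i => 0 * 0 + 0 * 0) :> ('I_d -> R).
        by apply/funext => i; rewrite mul0r addr0.
      by rewrite cov_formZDr !mul0r !addr0.
    have tp0 z z' : 0 <= two_point P omega z z'.
      by apply: le_trans (two_point_ge z z'); exact: sqr_ge0.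
    have i0 : 'I_d by apply: (Ordinal (n := d) (m := 0)); lia.
    (* Opposite steps separate the replicas by twice a unit vector; this one pair of steps already
       produces the whole drop [K]. *)
    pose z0 : step d := (i0, true); pose z1 : step d := (i0, false).
    have psi01 : psi (stepvec z0 - stepvec z1) <= inv_root4 (a + 1).
      apply: inv_root4_decr; first by rewrite addr_gt0.
      rewrite lerD2l; apply: le_trans (cov_form_ge d3 c_gt0 pc e1 _ i0).
      rewrite -[stepvec z0]add0r coords_disp /coords mxE /stepc /= eqxx !mulr1.
      by rewrite expr2; lra.
    pose W z z' := two_point P omega z z' * (e z * e z').
    have W0 z z' : 0 <= W z z' by rewrite !mulr_ge0.
    have W_sum : \sum_z \sum_z' W z z' <= 1 + 8 * tau.
      apply: (@le_trans _ _ (expR (4 * tau))).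
        have -> : expR (4 * tau) = (\sum_z \sum_z' two_point P omega z z') * expR (4 * tau).
          by rewrite two_point_sum mul1r.
        rewrite mulr_suml; apply: ler_sum => z _.
        rewrite mulr_suml; apply: ler_sum => z' _; rewrite ler_wpM2l//.
        have -> : 4 * tau = 2 * tau + 2 * tau by ring.
        rewrite expRD; apply: ler_pM => //.
          by have /andP[] := he z.
        by have /andP[] := he z'.
      have h1 : 1 - 4 * tau <= expR (- (4 * tau)) by exact: expR_ge1Dx.
      have h2 : expR (4 * tau) * expR (- (4 * tau)) = 1 by rewrite -expRD subrr expR0.
      have h3 := expR_gt0 (4 * tau); nra.
    have W01 : c1 ^+ 2 * expR (- 2) <= W z0 z1.
      rewrite ler_pM ?expR_ge0 ?sqr_ge0 ?two_point_ge//.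
      have -> : (- 2 : R) = - 1 + - 1 by ring.
      rewrite expRD; apply: ler_pM; rewrite ?expR_ge0//.
        have /andP[h _] := he z0; apply: le_trans h; rewrite ler_expR; lra.
      have /andP[h _] := he z1; apply: le_trans h; rewrite ler_expR; lra.
    have drop : K <= \sum_z \sum_z' W z z' * (psi 0 - psi (stepvec z - stepvec z')).
      have nn z z' : 0 <= W z z' * (psi 0 - psi (stepvec z - stepvec z')).
        by rewrite mulr_ge0// subr_ge0 psi00.
      rewrite (bigD1 z0)//= (bigD1 z1)//= -addrA; apply: ler_wpDr.
        by apply: addr_ge0; apply: sumr_ge0 => // z _; apply: sumr_ge0.
      apply: ler_pM => //; first by rewrite mulr_ge0 ?expR_ge0// sqr_ge0.
        exact: ltW.
      by rewrite psi00 /gap lerD2l lerN2.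
    have -> : \sum_z \sum_z' two_point P omega z z' * (e z * e z') *
        (1 + psi (stepvec z - stepvec z')) = (1 + psi 0) * (\sum_z \sum_z' W z z') -
        \sum_z \sum_z' W z z' * (psi 0 - psi (stepvec z - stepvec z')).
      rewrite mulr_sumr -sumrB; apply: eq_bigr => z _; rewrite mulr_sumr -sumrB.
      by apply: eq_bigr => z' _; rewrite /W; ring.
    have h : psi 0 <= 1 by rewrite psi00.
    have h0 := psi0 0.
    apply: (@le_trans _ _ ((1 + psi 0) * (1 + 8 * tau) - K)).
      by rewrite lerB// ler_wpM2l// addr_ge0.
    nra.
Qed.

End small_tilt.

(** * Almost sure growth of the partition function *)

(** Borel-Cantelli. The bound starts at index 1: division by zero gives 0, so at index 0 it would
    demand a null event. *)
Lemma ae_eventually_not (R : realType) (dT : measure_display) (T : measurableType dT)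
    (P : probability T R) (F : nat -> set T) (C : R) :
  0 <= C -> (forall k, measurable (F k)) ->
  (forall k, P (F k.+1) <= (C / k.+1%:R ^+ 2)%:E)%E ->
  {ae P, forall t, exists N, forall k, (N <= k)%N -> ~ F k t}.
Proof.
move=> C0 mF hF.
have : P (lim_sup_set F) = 0%E.
  apply: lim_sup_set_cvg0 => //.
  apply: (@le_lt_trans _ _ (1 + 2 * C)%:E); last exact: ltry.
  apply: lime_le; first exact: is_cvg_nneseries.
  apply: nearW => n; rewrite big_mkord.
  pose G (i : nat) : R := if i is j.+1 then C / j.+1%:R ^+ 2 else 1.
  apply: (@le_trans _ _ (\sum_(i < n) (G i)%:E)%E).
    apply: lee_sum => -[[|i] hi] _; first exact: probability_le1.
    exact: (hF i).
  rewrite sumEFin lee_fin; case: n => [|n].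
    by rewrite big_ord0 addr_ge0// mulr_ge0.
  rewrite big_ord_recl /= lerD2l.
  (* Telescoping majorant: 1/(i+1)^2 <= 2/(i+1) - 2/(i+2). *)
  suff : \sum_(i < n) C / i.+1%:R ^+ 2 <= 2 * C - 2 * C / n.+1%:R.
    move/le_trans; apply; rewrite gerDl oppr_le0 divr_ge0// mulr_ge0//.
  elim: n => [|n IH]; first by rewrite big_ord0 divr1 subrr.
  rewrite big_ord_recr /=.
  apply: le_trans (lerD IH (lexx _)) _.
  rewrite -subr_ge0.
  have n0 : 0 <= n%:R :> R by [].
  have e1 : n.+1%:R = 1 + n%:R :> R by rewrite -natr1 addrC.
  have e2 : n.+2%:R = 2 + n%:R :> R by rewrite -natr1 e1; ring.
  rewrite e1 e2 (_ : _ - _ = C * n%:R / ((1 + n%:R) ^+ 2 * (2 + n%:R))).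
    by rewrite divr_ge0 ?mulr_ge0 ?sqr_ge0// addr_ge0.
  by field; rewrite !gt_eqF//; lra.
move=> h0; rewrite /almost_everywhere /=.
apply: (@negligibleS _ _ _ _ (lim_sup_set F)).
  move=> t /= ht n _; apply: contrapT => hn; apply: ht; exists n => k nk Fk.
  by apply: hn; exists k.
by apply/negligibleP => //; apply: bigcap_measurable => // n _; exact: bigcup_measurable.
Qed.

Section almost_sure_bounds.
Context (R : realType) (d : nat) (dT : measure_display) (T : measurableType dT).
Context (P : probability T R) (omega : int -> 'rV[int]_d -> T -> step d -> R) (c1 : R).
Context (d3 : (3 <= d)%N).
Context (momega : forall n x z, measurable_fun setT (fun t => omega n x t z)).
Context (omega0 : forall n x t z, 0 <= omega n x t z).
Context (omega1 : forall n x t, \sum_(z : step d) omega n x t z = 1).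
Context (indep : env_independent P omega) (ident : env_identically_distributed P omega).
Context (c10 : 0 < c1) (elliptic : forall z, P [set t | c1 <= omega 0 0 t z] = 1%E).
Local Notation E := (Ex P).
Local Notation q := (qmean P omega).
Implicit Types (e : step d -> R).

Let phi e := \sum_z q z * e z.

Let phi_gt0 e : (forall z, 0 < e z) -> 0 < phi e.
Proof.
move=> e0; have i0 : 'I_d by apply: (Ordinal (n := d) (m := 0)); lia.
have q0 z : 0 < q z.
  by apply: lt_le_trans c10 _; exact: qmean_ge.
rewrite /phi (bigD1 (i0, true))//=; apply: ltr_pwDl; first exact: mulr_gt0.
by apply: sumr_ge0 => z _; rewrite mulr_ge0// ltW.
Qed.

Lemma partition_ge0 e L m x t : (forall z, 0 <= e z) -> 0 <= partition omega e L m x t.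
Proof.
move=> e0; elim: L m x => [|L IH] m x //=.
by apply: sumr_ge0 => z _; rewrite !mulr_ge0.
Qed.

Lemma partitionZ k e L m x t :
  partition omega (fun z => k * e z) L m x t = k ^+ L * partition omega e L m x t.
Proof.
elim: L m x => [|L IH] m x; first by rewrite mulr1.
rewrite /= mulr_sumr; apply: eq_bigr => z _; rewrite IH exprS; ring.
Qed.

(** Markov's inequality and Borel-Cantelli; the factor [n ^+ 2] buys summability and is invisible on
    the exponential scale. *)
Lemma partition_upper e : (forall z, 0 < e z) ->
  {ae P, forall t, exists N, forall n, (N <= n)%N ->
    partition omega e n 0 0 t <= n%:R ^+ 2 * phi e ^+ n}.
Proof.
move=> e0; have p0 := phi_gt0 e0.
have bp n : bounded_rv (partition omega e n 0 0) by exact: partition_bounded.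
have mA n : measurable [set t | n%:R ^+ 2 * phi e ^+ n <= partition omega e n 0 0 t].
  exact: measurable_superlevel (bp n).1.
have hA n : (P [set t | (n.+1%:R ^+ 2 * phi e ^+ n.+1 <= partition omega e n.+1 0 0 t)%R] <=
    (1 / n.+1%:R ^+ 2)%:E)%E.
  have pn : 0 < n.+1%:R ^+ 2 * phi e ^+ n.+1 by rewrite mulr_gt0 ?exprn_gt0.
  apply: le_trans (markov_ge P pn (bp _) _) _.
    by move=> t; apply: partition_ge0 => z; exact: ltW.
  rewrite lee_fin Ex_partition// le_eqVlt; apply/orP; left; apply/eqP.
  by rewrite /phi; field; rewrite !gt_eqF// exprn_gt0.
apply: filterS (ae_eventually_not ler01 mA hA) => t [N hN].
by exists N => n /hN /negP; rewrite -ltNge => /ltW.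
Qed.

(** Once the weight of each additional step is bounded below by [k], the transition probabilities
    sum to 1. *)
Lemma partition_tail e k L r m x t : (forall z, k <= e z) -> 0 <= k ->
  k ^+ r * partition omega e L m x t <= partition omega e (L + r) m x t.
Proof.
move=> ke k0; elim: L m x => [|L IH] m x.
  rewrite mulr1 add0n; elim: r m x => [|r IHr] m x //=.
  rewrite exprS -[leLHS]mul1r -(omega1 m%:Z x t) mulr_suml; apply: ler_sum => z _.
  rewrite mulrA; apply: ler_pM => //; first exact: mulr_ge0.
    exact: exprn_ge0.
  by apply: ler_wpM2l => //; exact: ke.
rewrite addSn /= mulr_sumr; apply: ler_sum => z _; rewrite mulrCA ler_wpM2l//.
by rewrite mulr_ge0// (le_trans k0).
Qed.

(** Only the paths beginning with [s] are kept, each step of [s] contributing at least [k] by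
    ellipticity. *)
Lemma partition_head e k L (s : seq (step d)) m x t : (forall n y z, c1 <= omega n y t z) ->
  (forall z, 0 <= e z) -> (forall z, k <= c1 * e z) -> 0 <= k ->
  k ^+ size s * partition omega e L (m + size s) (x + \sum_(z <- s) stepvec z) t <=
  partition omega e (size s + L) m x t.
Proof.
move=> hc e0 ke k0; elim: s m x => [|z s IH] m x.
  by rewrite expr0 mul1r big_nil addr0 addn0.
rewrite big_cons /= (bigD1 z)//=; apply: ler_wpDr.
  by apply: sumr_ge0 => z' _; rewrite !mulr_ge0 ?partition_ge0.
rewrite exprS -mulrA; apply: ler_pM => //.
- by rewrite mulr_ge0 ?exprn_ge0 ?partition_ge0.
- by apply: le_trans (ke z) _; rewrite ler_wpM2r.
- by apply: le_trans (IH m.+1 (x + stepvec z)); rewrite addSnnS addrA.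
Qed.

Context (i0 : 'I_d).

(** The factor 2 is for parity: the walk can be at an even multiple of a unit vector at the even
    time [warmup k]. *)
Definition start (k j : nat) : 'rV[int]_d := stepvec (i0, true) *+ (2 * k ^ 4 * j).

Definition warmup (k : nat) : nat := (2 * k ^ 6)%N.

(** Chosen so that warm-up and block together last k^7 steps for k >= 2; for k = 1 the subtraction
    is truncated. *)
Definition block (k : nat) : nat := (k ^ 7 - 2 * k ^ 6)%N.

Lemma start_reachable k j : (j < k ^ 2)%N -> exists s : seq (step d),
  size s = warmup k /\ \sum_(z <- s) stepvec z = start k j.
Proof.
move=> jk; set r := (k ^ 6 - k ^ 4 * j)%N.
have rE : (k ^ 4 * j + r = k ^ 6)%N.
  by rewrite subnKC// (expnD k 4 2) leq_mul2l (ltnW jk) orbT.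
(* A straight walk to the target, then [r] steps forward and [r] back to use up the remaining
   time. *)
exists (nseq (2 * k ^ 4 * j) (i0, true) ++ (nseq r (i0, true) ++ nseq r (i0, false))).
rewrite !size_cat !size_nseq; split; first by rewrite /warmup -rE; lia.
rewrite !big_cat /= !big_nseq !iter_addr_0.
have -> : stepvec (i0, false) = - stepvec (i0, true) :> 'rV[int]_d.
  by rewrite /stepvec /= scale1r scaleN1r.
by rewrite mulNrn subrr addr0.
Qed.

(** With K = (k+1)^2 points of mean 1, the covariances sum to at most K (diagonal, psi <= 1) plus
    K^2 / K (off-diagonal); dividing by K^2 gives 2/K. *)
Lemma block_second_moment e (psi : 'rV[int]_d -> R) k :
  \sum_z q z * e z = 1 -> (forall v, 0 <= psi v <= 1) ->
  (forall v i h, 0 < h -> h ^+ 4 <= coords R v i ^+ 2 -> psi v <= h^-1) ->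
  (forall L m x y,
      E (fun t => partition omega e L m x t * partition omega e L m y t) <= 1 + psi (x - y)) ->
  E (fun t => ((k.+1 ^ 2)%:R^-1 *
     \sum_(j < k.+1 ^ 2) partition omega e (block k.+1) (warmup k.+1) (start k.+1 j) t - 1) ^+ 2) <=
  2 / k.+1%:R ^+ 2.
Proof.
move=> e1 psi01 psi_decay hpsi.
set K := (k.+1 ^ 2)%N; set Z := fun j t => partition omega e (block k.+1) (warmup k.+1) (start k.+1 j) t.
have K0 : 0 < K%:R :> R by rewrite ltr0n expn_gt0.
have Kk : K%:R = k.+1%:R ^+ 2 :> R by rewrite natrX.
have bZ j : bounded_rv (Z j) by exact: partition_bounded.
have EZ j : E (Z j) = 1 by rewrite Ex_partition// e1 expr1n.
have sq t : (K%:R^-1 * \sum_(j < K) Z j t - 1) ^+ 2 =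
    (K%:R^-1 ^+ 2 * \sum_(i < K) \sum_(j < K) Z i t * Z j t) +
    ((- 2 * K%:R^-1) * (\sum_(j < K) Z j t) + 1).
  by rewrite -big_distrlr /=; ring.
under eq_fun do rewrite sq.
have b1 : bounded_rv (fun t => \sum_(i < K) \sum_(j < K) Z i t * Z j t).
  by apply: bounded_rv_sum => i; apply: bounded_rv_sum => j; exact: bounded_rvM.
have b2 : bounded_rv (fun t => \sum_(j < K) Z j t) by exact: bounded_rv_sum.
rewrite ExD; [|exact: bounded_rvZ|by apply: bounded_rvD; [exact: bounded_rvZ|exact: bounded_rv_cst]].
rewrite ExD; [|exact: bounded_rvZ|exact: bounded_rv_cst].
have S1 : E (fun t => \sum_(j < K) Z j t) = K%:R.
  by rewrite Ex_sum//; under eq_bigr do rewrite EZ; rewrite sumr_const card_ord.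
rewrite !ExZ// Ex_cst S1.
rewrite Ex_sum; last by move=> i; apply: bounded_rv_sum => j; exact: bounded_rvM.
have hpair (i j : 'I_K) : E (fun t => Z i t * Z j t) <= 1 + ((i == j)%:R + k.+1%:R ^- 2).
  apply: le_trans (hpsi _ _ _ _) _; rewrite lerD2l.
  case: eqVneq => [_|ij]; first by have /andP[_ h] := psi01 (start k.+1 i - start k.+1 j);
    rewrite (le_trans h)// lerDl invr_ge0 exprn_ge0.
  (* Used with h = (k+1)^2: distinct starts differ by at least 2 (k+1)^4 in coordinate [i0], and the
     square of this exceeds h^4. *)
  rewrite add0r; apply: (psi_decay _ i0); first by rewrite exprn_gt0.
  have -> : coords R (start k.+1 i - start k.+1 j) i0 = 2 * k.+1%:R ^+ 4 * (i%:R - j%:R) :> R.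
    rewrite /start /stepvec /coords /= scale1r !mxE !mulmxnE !mxE !eqxx /=.
    by rewrite rmorphB !rmorphMn rmorph1 !natrM; ring.
  have ij1 : 1 <= (i%:R - j%:R) ^+ 2 :> R.
    rewrite -real_normK ?num_real// exprn_ege1// -[leLHS]/(1%:R).
    have [lij|lij] := ltnP i j.
      by rewrite distrC ger0_norm ?subr_ge0 ?ler_nat 1?ltnW// -natrB 1?ltnW// ler_nat subn_gt0.
    have lij' : (j < i)%N by rewrite ltn_neqAle lij andbT eq_sym.
    by rewrite ger0_norm ?subr_ge0 ?ler_nat// -natrB// ler_nat subn_gt0.
  rewrite -exprM exprMn -[(2 * 4)%N]/(4 * 2)%N exprM exprMn.
  have h4 : 0 <= (k.+1%:R ^+ 4) ^+ 2 :> R by exact: sqr_ge0.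
  nra.
have hsum : \sum_(i < K) E (fun t => \sum_(j < K) Z i t * Z j t) <=
    K%:R ^+ 2 + (K%:R + K%:R).
  apply: (@le_trans _ _ (\sum_(i < K) \sum_(j < K) (1 + ((i == j)%:R + k.+1%:R ^- 2)))).
    apply: ler_sum => i _; rewrite Ex_sum; last by move=> j; exact: bounded_rvM.
    by apply: ler_sum => j _; exact: hpair.
  have inner (i : 'I_K) : \sum_(j < K) (1 + ((i == j)%:R + k.+1%:R ^- 2)) = K%:R + (1 + 1) :> R.
    rewrite !big_split /= !sumr_const card_ord; congr (_ + (_ + _)).
      by rewrite (bigD1 i)//= eqxx big1 ?addr0// => j ji; rewrite eq_sym (negbTE ji).
    by rewrite -[LHS]mulr_natl -Kk mulfV ?gt_eqF.
  under eq_bigr do rewrite inner.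
  rewrite sumr_const card_ord -[leLHS]mulr_natl le_eqVlt; apply/orP; left; apply/eqP; ring.
have K0' := gt_eqF K0.
rewrite -Kk.
apply: (@le_trans _ _ (K%:R^-1 ^+ 2 * (K%:R ^+ 2 + (K%:R + K%:R)) + (-2 / K%:R * K%:R + 1))).
  by rewrite lerD2r ler_wpM2l// sqr_ge0.
rewrite le_eqVlt; apply/orP; left; apply/eqP; field; by rewrite K0'.
Qed.

(** Chebyshev and Borel-Cantelli: if every start had Z < 1/2, the average would be at most 1/2 and
    its squared deviation from 1 at least 1/4. *)
Lemma good_blocks e (psi : 'rV[int]_d -> R) :
  \sum_z q z * e z = 1 -> (forall v, 0 <= psi v <= 1) ->
  (forall v i h, 0 < h -> h ^+ 4 <= coords R v i ^+ 2 -> psi v <= h^-1) ->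
  (forall L m x y,
      E (fun t => partition omega e L m x t * partition omega e L m y t) <= 1 + psi (x - y)) ->
  {ae P, forall t, exists N, forall k, (N <= k)%N -> exists2 j, (j < k ^ 2)%N &
    1 / 2 <= partition omega e (block k) (warmup k) (start k j) t}.
Proof.
move=> e1 psi01 psi_decay hpsi.
pose V k t := ((k ^ 2)%:R^-1 *
  \sum_(j < k ^ 2) partition omega e (block k) (warmup k) (start k j) t - 1) ^+ 2.
have bV k : bounded_rv (V k).
  have b : bounded_rv (fun t => (k ^ 2)%:R^-1 *
      \sum_(j < k ^ 2) partition omega e (block k) (warmup k) (start k j) t + (- 1)).
    apply: bounded_rvD; last exact: bounded_rv_cst.
    by apply: bounded_rvZ; apply: bounded_rv_sum => j; exact: partition_bounded.
  exact: (bounded_rvM b b).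
have V0 k t : 0 <= V k t by exact: sqr_ge0.
have mF k : measurable [set t | 1 / 4 <= V k t] by exact: measurable_superlevel (bV k).1.
have q0 : 0 < 1 / 4 :> R by lra.
have hF k : (P [set t | (1 / 4 <= V k.+1 t)%R] <= (8 / k.+1%:R ^+ 2)%:E)%E.
  apply: le_trans (markov_ge P q0 (bV k.+1) (V0 k.+1)) _.
  rewrite lee_fin ler_pdivrMr//.
  apply: le_trans (block_second_moment k e1 psi01 psi_decay hpsi) _.
  by rewrite le_eqVlt; apply/orP; left; apply/eqP; field; rewrite gt_eqF.
apply: filterS (ae_eventually_not (ler0n _ 8) mF hF) => t [N hN].
exists (maxn N 1) => k; rewrite geq_max => /andP[/hN /= hk k1].
apply: contrapT => hj; apply: hk.
have K0 : 0 < (k ^ 2)%:R :> R by rewrite ltr0n expn_gt0 k1.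
have : (k ^ 2)%:R^-1 * \sum_(j < k ^ 2) partition omega e (block k) (warmup k) (start k j) t <= 1 / 2.
  rewrite ler_pdivrMl// mulr_natl.
  rewrite -[leRHS](_ : \sum_(j < k ^ 2) (1 / 2) = _); last by rewrite sumr_const card_ord.
  apply: ler_sum => j _; rewrite leNgt; apply/negP => hlt; apply: hj.
  by exists j => //; exact: ltW.
by rewrite /V; set A := _ * _ => hA; nra.
Qed.

(** For k^7 <= n < (k+1)^7 the path reaches a good start, runs through the block, and spends the
    rest anywhere. The steps outside the block cost a fixed factor each and number O(n/k). *)
Lemma partition_lower e (b : R) t : 0 < b -> (forall z, b <= e z) ->
  (forall n y z, c1 <= omega n y t z) ->
  (exists N, forall k, (N <= k)%N -> exists2 j, (j < k ^ 2)%N &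
    1 / 2 <= partition omega (fun z => (phi e)^-1 * e z) (block k) (warmup k) (start k j) t) ->
  forall eps, 0 < eps -> exists N, forall n, (N <= n)%N ->
    phi e ^+ n * expR (- (eps * n%:R)) <= partition omega e n 0 0 t.
Proof.
move=> b0 be hc [N hN] eps eps0.
have e0 z : 0 < e z by exact: lt_le_trans (be z).
have p0 := phi_gt0 e0.
have c1_le1 : c1 <= 1 by apply: le_trans (hc 0 0 (i0, true)) _; exact: omega_le1.
pose kap := c1 * b.
have kap0 : 0 < kap by exact: mulr_gt0.
have kap_c z : kap <= c1 * e z by rewrite ler_wpM2l// ltW.
have kap_e z : kap <= e z by apply: le_trans (kap_c z) _; rewrite ler_piMl// ltW.
(* [r] is the number of steps spent outside the block *)
have key k n : (2 <= k)%N -> (N <= k)%N -> (k ^ 7 <= n)%N -> (n < k.+1 ^ 7)%N ->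
    exists r, [/\ (r <= n)%N, (r * k <= 129 * n)%N &
      kap ^+ r * phi e ^+ (n - r) / 2 <= partition omega e n 0 0 t].
  move=> k2 kN kn nk.
  have [j jk hj] := hN k kN; have [s [size_s sum_s]] := start_reachable jk.
  exists (warmup k + (n - k ^ 7))%N.
  have k67 : (2 * k ^ 6 <= k ^ 7)%N by rewrite (expnS k 6) leq_mul2r k2 orbT.
  have nE : (n = warmup k + (block k + (n - k ^ 7)))%N by rewrite /warmup /block; lia.
  split; first by rewrite [leqRHS]nE leq_add2l leq_addl.
    (* 127 = 2^7 - 1 is the sum of the lower binomial coefficients; with the warm-up 2 k^6 it makes
       129. *)
    have grow : (k.+1 ^ 7 <= k ^ 7 + 127 * k ^ 6)%N by nia.
    have h1 : (warmup k + (n - k ^ 7) <= 129 * k ^ 6)%N by rewrite /warmup; lia.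
    apply: leq_trans (leq_mul h1 (leqnn k)) _.
    by rewrite -mulnA -expnSr leq_mul2l.
  have nr : (n - (warmup k + (n - k ^ 7)) = block k)%N by rewrite {1}nE; lia.
  rewrite nr [X in partition _ _ X]nE -size_s.
  have h0 : 0 <= kap ^+ size s by rewrite exprn_ge0// ltW.
  apply: le_trans (partition_head (block k + (n - k ^ 7)) s 0 0 hc _ kap_c (ltW kap0)); last first.
    by move=> z; exact: ltW.
  rewrite add0n add0r sum_s exprD -!mulrA ler_wpM2l// size_s.
  apply: le_trans (partition_tail _ _ _ _ _ kap_e (ltW kap0)).
  rewrite ler_wpM2l// ?exprn_ge0 ?(ltW kap0)//.
  move: hj; rewrite partitionZ exprVn ler_pdivlMl ?exprn_gt0// mul1r.
  by rewrite /=; lra.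
have [B B0 hB] : exists2 B, 0 <= B & phi e * expR (- B) <= kap.
  exists (`|ln (phi e / kap)|) => //.
  have pk : 0 < phi e / kap by exact: divr_gt0.
  apply: (@le_trans _ _ (phi e * expR (- ln (phi e / kap)))).
    by rewrite ler_pM2l// ler_expR lerN2 ler_norm.
  rewrite expRN lnK ?posrE// invf_div mulrCA mulfV ?gt_eqF// mulr1//.
(* 258 = 2 * 129 makes the cost r B at most half of eps n; the other half is at least 1 and pays for
   the factor 1/2 of the block, as e >= 2. *)
pose k0 := maxn (maxn N 2) (Num.truncn (258 * B / eps)).+1.
exists (maxn (k0 ^ 7) (Num.truncn (2 / eps)).+1) => n; rewrite geq_max => /andP[nk0 neps].
have [k [kk0 kn nk]] : exists k, [/\ (k0 <= k)%N, (k ^ 7 <= n)%N & (n < k.+1 ^ 7)%N].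
  pose Q k := (k ^ 7 <= n)%N.
  have exQ : exists k, Q k by exists k0.
  have ubQ k : Q k -> (k <= n)%N by apply: leq_trans; case: k => // k; rewrite expnS leq_pmulr ?expn_gt0.
  exists (ex_maxn exQ ubQ); case: ex_maxnP => i Qi maxi.
  by split => //; [exact: maxi|rewrite ltnNge; apply/negP => /maxi; rewrite ltnn].
have [k02 [k0N k0B]] : (2 <= k)%N /\ (N <= k)%N /\ 258 * B / eps <= k%:R.
  move: kk0; rewrite !geq_max => /andP[/andP[h1 h2] h3]; split => //; split => //.
  by apply: le_trans (ltW (truncnS_gt _)) _; rewrite ler_nat.
have [r [rn rk hr]] := key k n k02 k0N kn nk.
apply: le_trans hr.
have -> : phi e ^+ n = phi e ^+ r * phi e ^+ (n - r) by rewrite -exprD subnKC.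
rewrite mulrAC [leRHS]mulrAC; apply: ler_wpM2r; first by rewrite exprn_ge0// ltW.
apply: (@le_trans _ _ ((phi e * expR (- B)) ^+ r / 2)); last first.
  apply: ler_wpM2r; first by rewrite invr_ge0.
  by rewrite lerXn2r ?nnegrE// ?mulr_ge0 ?expR_ge0// ltW.
rewrite exprMn -mulrA ler_wpM2l ?exprn_ge0 ?(ltW p0)//.
rewrite ler_pdivlMr// -expRM_natl mulrC.
apply: (@le_trans _ _ (expR 1 * expR (- (eps * n%:R)))).
  by rewrite ler_wpM2r ?expR_ge0//; have := expR_ge1Dx (1 : R); lra.
rewrite -expRD ler_expR.
have kr0 : 0 < k%:R :> R by rewrite ltr0n; exact: leq_trans k02.
have n2 : 2 <= eps * n%:R.
  rewrite -ler_pdivrMl// mulrC; apply: le_trans (ltW (truncnS_gt _)) _; by rewrite ler_nat.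
have rk' : r%:R * k%:R <= 129 * n%:R :> R by rewrite -!natrM ler_nat.
have Bk : 258 * B <= k%:R * eps by rewrite -ler_pdivrMr.
have : 2 * (r%:R * B) * k%:R <= (eps * n%:R) * k%:R.
  have h1 : (r%:R * k%:R) * (2 * B) <= 129 * n%:R * (2 * B) by rewrite ler_wpM2r// mulr_ge0.
  have h2 : 258 * B * n%:R <= k%:R * eps * n%:R by rewrite ler_wpM2r.
  lra.
rewrite ler_pM2r//; lra.
Qed.

End almost_sure_bounds.

(** * The averaged logarithmic moment generating function *)

Section log_mgf.
Context (R : realType) (d : nat) (q : step d -> R) (c1 : R).
Context (d0 : (0 < d)%N) (c10 : 0 < c1) (qc : forall z, c1 <= q z) (q1 : \sum_z q z = 1).
Implicit Types (th xi : 'rV[R]_d).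

Lemma dotR_zvec th z : dotR th (zvec R z) = th 0 z.1 * (if z.2 then 1 else -1).
Proof.
rewrite /dotR (bigD1 z.1)//= big1 ?addr0.
  by rewrite /zvec /stepvec !mxE !eqxx /= mulr1; case: z.2.
by move=> i iz; rewrite /zvec /stepvec !mxE (negbTE iz) andbF mulr0 mulr0.
Qed.

Lemma dotRDl th th' xi : dotR (th + th') xi = dotR th xi + dotR th' xi.
Proof. by rewrite /dotR -big_split; apply: eq_bigr => i _; rewrite mxE mulrDl. Qed.

Lemma dotRDr th xi xi' : dotR th (xi + xi') = dotR th xi + dotR th xi'.
Proof. by rewrite /dotR -big_split; apply: eq_bigr => i _; rewrite mxE mulrDr. Qed.

Lemma dotRZl (k : R) th xi : dotR (k *: th) xi = k * dotR th xi.
Proof. by rewrite /dotR mulr_sumr; apply: eq_bigr => i _; rewrite mxE mulrA. Qed.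

Lemma dotRZr (k : R) th xi : dotR th (k *: xi) = k * dotR th xi.
Proof. by rewrite /dotR mulr_sumr; apply: eq_bigr => i _; rewrite mxE mulrCA. Qed.

Lemma dotRBr th xi xi' : dotR th (xi - xi') = dotR th xi - dotR th xi'.
Proof. by rewrite -scaleN1r dotRDr dotRZr mulN1r. Qed.

Lemma dotRBl th th' xi : dotR (th - th') xi = dotR th xi - dotR th' xi.
Proof. by rewrite -scaleN1r dotRDl dotRZl mulN1r. Qed.

Lemma dotR_le th xi (a b : R) : (forall i, `|th 0 i| <= a) -> (forall i, `|xi 0 i| <= b) ->
  `|dotR th xi| <= d%:R * (a * b).
Proof.
move=> ha hb; apply: le_trans (ler_norm_sum _ _ _) _.
rewrite mulr_natl -[d in leRHS]card_ord -sumr_const; apply: ler_sum => i _.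
by rewrite normrM ler_pM.
Qed.

Let q_gt0 z : 0 < q z. Proof. exact: lt_le_trans (qc z). Qed.

Definition mgf th := \sum_z q z * expR (dotR th (zvec R z)).

Lemma sum_gt0 (F : step d -> R) : (forall z, 0 < F z) -> 0 < \sum_z F z.
Proof.
move=> F0; rewrite (bigD1 (Ordinal d0, true))//=; apply: ltr_pwDl => //.
by apply: sumr_ge0 => z _; exact: ltW.
Qed.

Lemma mgf_gt0 th : 0 < mgf th.
Proof. by apply: sum_gt0 => z; rewrite mulr_gt0// expR_gt0. Qed.

Lemma expR_Lambda th : expR (Lambda_c q th) = mgf th.
Proof. by rewrite /Lambda_c lnK// posrE mgf_gt0. Qed.

Lemma Lambda0 : Lambda_c q 0 = 0.
Proof.
rewrite /Lambda_c (eq_bigr q) ?q1 ?ln1// => z _.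
by rewrite dotR_zvec mxE mul0r expR0 mulr1.
Qed.

(** A unit step reads a single coordinate of the tilt, so the Lipschitz constant in the sup norm is
    1; this makes rational tilts sufficient. *)
Lemma Lambda_lip th th' (b : R) : (forall i, `|th 0 i - th' 0 i| <= b) ->
  Lambda_c q th <= Lambda_c q th' + b.
Proof.
move=> hb; rewrite -ler_expR expRD !expR_Lambda /mgf mulr_suml; apply: ler_sum => z _.
rewrite -mulrA ler_wpM2l ?(ltW (q_gt0 z))// -expRD ler_expR -lerBlDl !dotR_zvec -mulrBl.
apply: le_trans (hb z.1); apply: le_trans (ler_norm _) _.
by rewrite normrM; case: z.2; rewrite ?normrN1 ?normr1 mulr1.
Qed.

(** The linear terms at th + tau z and th - tau z are opposite, so they only decrease the product of
    the two generating functions; the quadratic remainders give 2 tau^2. *)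
Lemma Lambda_second_difference th (tau : R) z : 0 <= tau <= 1 / 3 ->
  Lambda_c q (th + tau *: zvec R z) + Lambda_c q (th - tau *: zvec R z) <=
  2 * Lambda_c q th + 2 * tau ^+ 2.
Proof.
move=> /andP[t0 t1].
(* The bound 1/3 makes 1 - 3x + x^2 nonnegative, the factor left after comparing e^x with (1 -
   x/2)^(-2). *)
have exp_le (x : R) : `|x| <= 1 / 3 -> expR x <= 1 + x + x ^+ 2.
  rewrite ler_norml => /andP[x1 x2].
  have h1 : 1 - x / 2 <= expR (- (x / 2)) by exact: expR_ge1Dx.
  have h2 : expR x * expR (- (x / 2)) ^+ 2 = 1.
    by rewrite expr2 -!expRD (_ : _ + _ = 0) ?expR0//; field.
  have h3 : (1 - x / 2) ^+ 2 <= expR (- (x / 2)) ^+ 2.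
    by rewrite lerXn2r ?nnegrE ?expR_ge0//; lra.
  have h4 : 1 <= (1 + x + x ^+ 2) * (1 - x / 2) ^+ 2.
    rewrite -subr_ge0 (_ : _ - 1 = x ^+ 2 / 4 * (1 - 3 * x + x ^+ 2)); last by field.
    rewrite mulr_ge0 ?divr_ge0 ?sqr_ge0//; have := sqr_ge0 x; lra.
  have h5 : 0 < expR (- (x / 2)) ^+ 2 by rewrite exprn_gt0// expR_gt0.
  rewrite -(ler_pM2r h5) h2; apply: le_trans h4 _; apply: ler_wpM2l => //.
  by have := sqr_ge0 x; lra.
pose v z' := dotR (zvec R z) (zvec R z').
have hv z' : `|v z'| <= 1.
  rewrite /v dotR_zvec /zvec /stepvec !mxE.
  by case: z.2; case: z'.2; case: (_ && _); rewrite ?(mulr0, mulr1, mulrN1) ?(rmorphN, rmorph1, rmorph0)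
    ?(mulr0, mul0r, opprK, normrN, normr1, normr0).
pose W z' := q z' * expR (dotR th (zvec R z')).
have W0 z' : 0 <= W z' by rewrite mulr_ge0 ?expR_ge0// ltW.
have hphi (sg : R) : `|sg| = 1 -> mgf (th + (sg * tau) *: zvec R z) <=
    mgf th * (1 + tau ^+ 2) + sg * tau * \sum_z' W z' * v z'.
  move=> hsg; rewrite /mgf mulr_suml mulr_sumr -big_split /=; apply: ler_sum => z' _.
  rewrite dotRDl dotRZl expRD mulrA -/(W z') -/(v z').
  have hx : `|sg * tau * v z'| <= tau.
    by rewrite !normrM hsg mul1r (ger0_norm t0) ler_piMr.
  have := exp_le _ (le_trans hx t1).
  have hx2 : (sg * tau * v z') ^+ 2 <= tau ^+ 2.
    by rewrite -real_normK ?num_real// lerXn2r ?nnegrE.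
  move=> h; apply: (@le_trans _ _ (W z' * (1 + sg * tau * v z' + tau ^+ 2))).
    by rewrite ler_wpM2l//; lra.
  by rewrite le_eqVlt; apply/orP; left; apply/eqP; ring.
have := hphi 1 (normr1 _); have := hphi (-1) (normrN1 _).
rewrite !mul1r mulN1r scaleNr => hm hp.
set b := \sum_z' _ in hm hp.
have hprod : mgf (th + tau *: zvec R z) * mgf (th - tau *: zvec R z) <=
    (mgf th * (1 + tau ^+ 2)) ^+ 2.
  apply: (@le_trans _ _ ((mgf th * (1 + tau ^+ 2) + tau * b) * (mgf th * (1 + tau ^+ 2) + - tau * b))).
    by apply: ler_pM => //; exact/ltW/mgf_gt0.
  have := sqr_ge0 (tau * b); rewrite !expr2; lra.
have := mgf_gt0 (th + tau *: zvec R z); have := mgf_gt0 (th - tau *: zvec R z).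
move=> g1 g2; have g3 := mgf_gt0 th.
have t2 : 0 < 1 + tau ^+ 2 by have := sqr_ge0 tau; lra.
rewrite -ler_expR expRD !expR_Lambda; apply: le_trans hprod _.
have -> : 2 * Lambda_c q th + 2 * tau ^+ 2 = (Lambda_c q th + tau ^+ 2) * 2%:R by ring.
rewrite expRM_natr expRD expR_Lambda lerXn2r ?nnegrE ?mulr_ge0 ?expR_ge0 ?(ltW g3) ?(ltW t2)//.
by rewrite ler_pM2l// expR_ge1Dx.
Qed.

Lemma xi_o_dot th : dotR th (xi_o q) = \sum_z q z * dotR th (zvec R z).
Proof.
rewrite /dotR /xi_o; under eq_bigr do rewrite summxE mulr_sumr.
rewrite exchange_big /=; apply: eq_bigr => z _; rewrite mulr_sumr; apply: eq_bigr => i _.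
by rewrite mxE mulrCA.
Qed.

(** The right side is the log moment generating function of the centred variable u, with |u| <= 1,
    so that e^u >= (1 + u/2)^2. Its variance is bounded below by the two steps along axis [i]
    alone. *)
Lemma Lambda_coercive th (tau : R) i : tau <= 1 / 2 -> (forall j, `|th 0 j| <= tau) ->
  ln (1 + c1 * th 0 i ^+ 2 / 2) <= Lambda_c q th - dotR th (xi_o q).
Proof.
move=> t2 ht; set b := dotR th (xi_o q).
have hz z : `|dotR th (zvec R z)| <= tau.
  by rewrite dotR_zvec normrM; case: z.2; rewrite ?normrN1 ?normr1 mulr1.
have hb : `|b| <= tau.
  rewrite /b xi_o_dot; apply: le_trans (ler_norm_sum _ _ _) _.
  rewrite -[leRHS]mul1r -q1 mulr_suml; apply: ler_sum => z _.
  by rewrite normrM (gtr0_norm (q_gt0 z)) ler_wpM2l// ltW.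
pose u z := dotR th (zvec R z) - b.
have exp_ge z : 1 + u z + u z ^+ 2 / 4 <= expR (u z).
  have h1 : 1 + u z / 2 <= expR (u z / 2) by exact: expR_ge1Dx.
  have -> : expR (u z) = expR (u z / 2) ^+ 2 by rewrite expr2 -expRD; congr expR; field.
  rewrite (_ : 1 + u z + u z ^+ 2 / 4 = (1 + u z / 2) ^+ 2); last by field.
  rewrite lerXn2r ?nnegrE ?expR_ge0// /u.
  by have := hz z; rewrite ler_norml; move: hb; rewrite ler_norml; lra.
have hE : mgf th * expR (- b) = \sum_z q z * expR (u z).
  by rewrite /mgf mulr_suml; apply: eq_bigr => z _; rewrite -mulrA -expRD.
have u0 : \sum_z q z * u z = 0.
  rewrite /u; under eq_bigr do rewrite mulrBr.
  by rewrite sumrB -mulr_suml q1 mul1r -xi_o_dot subrr.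
have u2 : 2 * c1 * th 0 i ^+ 2 <= \sum_z q z * u z ^+ 2.
  have ne : (i, false) != (i, true) by rewrite xpair_eqE andbF.
  rewrite (bigD1 (i, true))//= (bigD1 (i, false) ne)/= [leRHS]addrA; apply: ler_wpDr.
    by apply: sumr_ge0 => z _; rewrite mulr_ge0 ?sqr_ge0// ltW.
  apply: (@le_trans _ _ (c1 * u (i, true) ^+ 2 + c1 * u (i, false) ^+ 2)).
    rewrite /u !dotR_zvec /=; have := mulr_ge0 (ltW c10) (sqr_ge0 b).
    by rewrite !expr2; lra.
  by rewrite lerD// ler_wpM2r// sqr_ge0.
have hS : 1 + c1 * th 0 i ^+ 2 / 2 <= mgf th * expR (- b).
  rewrite hE; apply: (@le_trans _ _ (\sum_z q z * (1 + u z + u z ^+ 2 / 4))); last first.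
    by apply: ler_sum => z _; rewrite ler_wpM2l// ltW.
  rewrite (eq_bigr (fun z => q z + q z * u z + (q z * u z ^+ 2) / 4)); last by move=> z _; ring.
  by rewrite !big_split /= -mulr_suml q1 u0; lra.
have pos : 0 < 1 + c1 * th 0 i ^+ 2 / 2.
  by have := mulr_ge0 (ltW c10) (sqr_ge0 (th 0 i)); lra.
by rewrite -ler_expR lnK ?posrE// expRD expR_Lambda.
Qed.

End log_mgf.

(** * Path expansion of the partition function *)

Section path_sum.
Context (R : realType) (d : nat) (dT : measure_display) (T : measurableType dT).
Context (omega : int -> 'rV[int]_d -> T -> step d -> R).

Definition scons n (z : step d) (s : {ffun 'I_n -> step d}) : {ffun 'I_n.+1 -> step d} :=
  [ffun i => if unlift ord0 i is Some j then s j else z].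

Lemma scons0 n z (s : {ffun 'I_n -> step d}) : scons z s ord0 = z.
Proof. by rewrite ffunE unlift_none. Qed.

Lemma sconsS n z (s : {ffun 'I_n -> step d}) i : scons z s (lift ord0 i) = s i.
Proof. by rewrite ffunE liftK. Qed.

Lemma sum_scons n (V : nmodType) (F : {ffun 'I_n.+1 -> step d} -> V) :
  \sum_s F s = \sum_z \sum_s F (scons z s).
Proof.
rewrite pair_big /= (reindex (fun p : step d * {ffun 'I_n -> step d} => scons p.1 p.2)) //=.
exists (fun s => (s ord0, [ffun i => s (lift ord0 i)])) => [[z s]|s] _ /=.
  by rewrite scons0; congr (_, _); apply/ffunP => i; rewrite ffunE sconsS.
by apply/ffunP => i; rewrite ffunE; case: unliftP => [j|] ->; rewrite ?ffunE.
Qed.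

Lemma walk_pos_scons n z (s : {ffun 'I_n -> step d}) k :
  walk_pos (scons z s) k.+1 = stepvec z + walk_pos s k.
Proof.
rewrite /walk_pos big_mkcond big_ord_recl /= scons0; congr (_ + _).
by rewrite [RHS]big_mkcond; apply: eq_bigr => i _; rewrite sconsS /bump.
Qed.

Lemma path_sum e n m x t :
  \sum_(s : {ffun 'I_n -> step d})
    \prod_(k < n) (omega (m + k)%N%:Z (x + walk_pos s k) t (s k) * e (s k)) =
  partition omega e n m x t.
Proof.
elim: n m x => [|n IH] m x /=.
  under eq_bigr do rewrite big_ord0.
  by rewrite sumr_const card_ffun card_ord expn0.
rewrite sum_scons; apply: eq_bigr => z _; rewrite -IH mulr_sumr; apply: eq_bigr => s _.
rewrite big_ord_recl scons0 addn0 {1}/walk_pos big1 ?addr0//; congr (_ * _).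
apply: eq_bigr => k _; rewrite sconsS.
by rewrite /= /bump /= add1n -addSnnS walk_pos_scons addrA.
Qed.

Lemma dotR_walk n (s : {ffun 'I_n -> step d}) (th : 'rV[R]_d) :
  expR (dotR th (map_mx (fun a : int => a%:~R) (walk_pos s n))) =
  \prod_(k < n) expR (dotR th (zvec R (s k))).
Proof.
rewrite -expR_sum; congr expR; rewrite /dotR /walk_pos exchange_big /=.
apply: eq_bigr => i _; rewrite mxE summxE rmorph_sum /= mulr_sumr big_mkcond.
by apply: eq_bigr => k _; rewrite ltn_ord [zvec _ _ _ _]mxE.
Qed.

End path_sum.

(** * From moment generating functions to large deviations *)

Section asymptotics.
Context (R : realType).

(** A cube beats a square: e^x >= (x/3)^3, whence the 27. *)
Lemma square_le_exp (K eps : R) : 0 < eps ->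
  exists N, forall n, (N <= n)%N -> K * n%:R ^+ 2 <= expR (eps * n%:R).
Proof.
move=> e0; exists (Num.truncn (27 * K / eps ^+ 3)).+1 => n nN.
have h : 27 * K / eps ^+ 3 <= n%:R.
  by apply: le_trans (ltW (truncnS_gt _)) _; rewrite ler_nat.
have n0 : 0 <= n%:R :> R by [].
have -> : expR (eps * n%:R) = expR (eps * n%:R / 3) ^+ 3.
  by rewrite -expRM_natl; congr expR; field.
apply: (@le_trans _ _ ((eps * n%:R / 3) ^+ 3)); last first.
  rewrite lerXn2r ?nnegrE ?expR_ge0 ?divr_ge0 ?mulr_ge0 ?(ltW e0)//.
  by apply: le_trans (expR_ge1Dx _); rewrite lerDr.
have -> : (eps * n%:R / 3) ^+ 3 = (n%:R * eps ^+ 3 / 27) * n%:R ^+ 2 by field.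
rewrite ler_wpM2r ?sqr_ge0// ler_pdivlMr//.
by move: h; rewrite ler_pdivrMr ?exprn_gt0//; lra.
Qed.

Lemma elog_le (n : nat) (p A : R) : (0 < n)%N -> 0 <= p -> p <= expR (n%:R * A) ->
  (n%:R^-1%:E * elog p <= A%:E)%E.
Proof.
move=> n0 p0 pA; have n0' : 0 < n%:R :> R by rewrite ltr0n.
rewrite /elog; case: eqVneq => [_|pn].
  by rewrite mulrNy gtr0_sg ?invr_gt0// mul1e leNye.
rewrite -EFinM lee_fin ler_pdivrMl// -ler_expR lnK// posrE.
by rewrite lt_neqAle eq_sym pn.
Qed.

Lemma elog_ge (n : nat) (p A : R) : (0 < n)%N -> expR (n%:R * A) <= p ->
  (A%:E <= n%:R^-1%:E * elog p)%E.
Proof.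
move=> n0 pA; have n0' : 0 < n%:R :> R by rewrite ltr0n.
have p0 : 0 < p by apply: lt_le_trans pA; exact: expR_gt0.
by rewrite /elog gt_eqF// -EFinM lee_fin ler_pdivlMl// -ler_expR lnK// posrE.
Qed.

Lemma limn_esup_le_eventually (u : nat -> \bar R) (A : \bar R) :
  (exists N, forall n, (N <= n)%N -> (u n <= A)%E) -> (limn_esup u <= A)%E.
Proof.
move=> [N hN]; rewrite limn_esup_lim; apply: lime_le; first exact: is_cvg_esups.
exists N => // m /= Nm; apply: ge_ereal_sup => _ [k /= mk <-].
by apply: hN; exact: leq_trans mk.
Qed.

Lemma limn_einf_ge_eventually (u : nat -> \bar R) (A : \bar R) :
  (exists N, forall n, (N <= n)%N -> (A <= u n)%E) -> (A <= limn_einf u)%E.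
Proof.
move=> [N hN]; rewrite limn_einf_lim; apply: lime_ge; first exact: is_cvg_einfs.
exists N => // m /= Nm; apply: le_ereal_inf_tmp => _ [k /= mk <-].
by apply: hN; exact: leq_trans mk.
Qed.

Lemma eventually_all (I : eqType) (s : seq I) (Q : I -> nat -> Prop) :
  (forall i, i \in s -> exists N, forall n, (N <= n)%N -> Q i n) ->
  exists N, forall n, (N <= n)%N -> forall i, i \in s -> Q i n.
Proof.
elim: s => [|a s IH] h; first by exists 0%N.
have [N1 h1] := h a (mem_head _ _).
have [|N2 h2] := IH; first by move=> i si; apply: h; rewrite in_cons si orbT.
exists (maxn N1 N2) => n; rewrite geq_max => /andP[n1 n2] i; rewrite in_cons => /orP[/eqP ->|].
  exact: h1.
exact: h2.
Qed.

Lemma rat_vector_dense d (th : 'rV[R]_d) (b : R) : 0 < b ->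
  exists rho : 'rV[rat]_d, forall i, `|th 0 i - map_mx ratr rho 0 i| <= b.
Proof.
move=> b0; have h i : exists x : rat, `|th 0 i - ratr x| <= b.
  have [|x] := @rat_in_itvoo R (th 0 i - b) (th 0 i + b); first lra.
  by rewrite in_itv /= => /andP[h1 h2]; exists x; rewrite ler_norml; lra.
have [f hf] := choice h.
by exists (\row_i f i) => i; rewrite !mxE.
Qed.

Lemma nbhs_boxP d (xi : 'rV[R]_d) (A : set 'rV[R]_d) : nbhs xi A <->
  exists2 eps : R, 0 < eps & forall y : 'rV[R]_d, (forall i, `|xi 0 i - y 0 i| < eps) -> A y.
Proof.
split=> [/nbhs_ballP [eps e0 h]|[eps e0 h]].
  exists eps => // y hy; apply: h; split => // i j; rewrite (ord1 i); exact: hy.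
by apply/nbhs_ballP; exists eps => // y [_ hy]; apply: h => i; exact: hy.
Qed.

Lemma open_half_space d (th : 'rV[R]_d) (a : R) : open [set y : 'rV[R]_d | a < dotR th y].
Proof.
rewrite openE => y /= ay; apply/nbhs_boxP.
pose b := \sum_i `|th 0 i|.
have b0 : 0 <= b by exact: sumr_ge0.
have hb i : `|th 0 i| <= b by rewrite /b (bigD1 i)//= lerDl sumr_ge0.
pose m := d%:R * b + 1.
have m0 : 0 < m by rewrite ltr_wpDl// mulr_ge0.
exists ((dotR th y - a) / m) => [|y' hy]; first by rewrite divr_gt0// subr_gt0.
have := @dotR_le _ _ th (y - y') b ((dotR th y - a) / m) hb.
have hy' i : `|(y - y') 0 i| <= (dotR th y - a) / m by rewrite !mxE; exact: ltW.
move=> /(_ hy'); rewrite dotRBr => h.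
suff : d%:R * (b * ((dotR th y - a) / m)) < dotR th y - a.
  by move: h; rewrite ler_norml /=; lra.
rewrite !mulrA ltr_pdivrMr// /m.
have : 0 < dotR th y - a by rewrite subr_gt0.
by move: (dotR th y - a) => g g0; lra.
Qed.

Lemma bounded_closure_compact d (G : set 'rV[R]_d) (b : R) :
  (forall y, G y -> forall i, `|y 0 i| <= b) -> compact (closure G).
Proof.
move=> hG; pose B := [set v : 'rV[R]_d | forall i : 'I_d, `[- b, b]%classic (v ord0 i)].
have cB : compact B by apply: (@rV_compact R d (fun=> `[- b, b]%classic)) => i; exact: segment_compact.
apply: (subclosed_compact _ cB); first exact: closed_closure.
move=> y hy i; rewrite /= in_itv /= -ler_norml; apply/ler_addgt0Pr => e e0.
have : nbhs y [set y' : 'rV[R]_d | forall j, `|y 0 j - y' 0 j| < e].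
  by apply/nbhs_boxP; exists e.
move=> /hy [y' [/hG /(_ i) h1 /(_ i) h2]].
apply: le_trans (lerD h1 (ltW h2)); rewrite addrC -[y 0 i](subrK (y' 0 i)).
by rewrite (le_trans (ler_normD _ _))// subrK.
Qed.

End asymptotics.

(** * Upper and lower large deviation bounds in a fixed environment *)

Section quenched_ldp.
Context (R : realType) (d : nat) (dT : measure_display) (T : measurableType dT).
Context (omega : int -> 'rV[int]_d -> T -> step d -> R) (t : T).
Context (q : step d -> R) (c1 : R).
Context (d0 : (0 < d)%N) (c10 : 0 < c1) (qc : forall z, c1 <= q z) (q1 : \sum_z q z = 1).
Context (omega0 : forall n x z, 0 <= omega n x t z).
Local Notation ratv rho := (map_mx ratr rho : 'rV[R]_d).

Let weight n (s : {ffun 'I_n -> step d}) := \prod_(k < n) omega k%:Z (walk_pos s k) t (s k).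
Let pos n (s : {ffun 'I_n -> step d}) : 'rV[R]_d := map_mx (fun a : int => a%:~R) (walk_pos s n).

Let weight_ge0 n (s : {ffun 'I_n -> step d}) : 0 <= weight s.
Proof. exact: prodr_ge0. Qed.

Definition tilt (th : 'rV[R]_d) (z : step d) := expR (dotR th (zvec R z)).

Definition quenched_mgf (th : 'rV[R]_d) n := partition omega (tilt th) n 0 0 t.

Let quenched_mgfE th n : quenched_mgf th n =
  \sum_(s : {ffun 'I_n -> step d}) weight s * expR (dotR th (pos s)).
Proof.
rewrite /quenched_mgf -path_sum; apply: eq_bigr => s _.
rewrite dotR_walk -big_split; apply: eq_bigr => k _ /=.
by rewrite add0n add0r.
Qed.

Let quenched_prob_ge0 n G : 0 <= quenched_prob omega t n G.
Proof. by apply: sumr_ge0 => s _; rewrite mulr_ge0// ?weight_ge0// indicE. Qed.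

Context (mgf_upper : forall rho : 'rV[rat]_d, exists N, forall n, (N <= n)%N ->
  quenched_mgf (ratv rho) n <= n%:R ^+ 2 * mgf q (ratv rho) ^+ n).

Let mgfX th n : mgf q th ^+ n = expR (n%:R * Lambda_c q th).
Proof. by rewrite expRM_natl (expR_Lambda d0 c10 qc). Qed.

(* Cramer-Chernoff: cover the compact closure by half-spaces with rational normals. *)
Lemma ldp_upper (G : set 'rV[R]_d) (b r : R) : (forall y, G y -> forall i, `|y 0 i| <= b) ->
  (forall xi, closure G xi -> (r%:E < I_c q xi)%E) ->
  (limn_esup (ldp_seq omega t G) <= (- r)%:E)%E.
Proof.
move=> hb hr; have := bounded_closure_compact hb; rewrite compact_cover => cG.
pose f (rho : 'rV[rat]_d) := [set y : 'rV[R]_d | r + Lambda_c q (ratv rho) < dotR (ratv rho) y].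
have [|xi hxi|D _ hD] := cG 'rV[rat]_d setT f.
- by move=> rho _; exact: open_half_space.
- have /ereal_sup_gt [_ [th _ <-]] := hr xi hxi; rewrite lte_fin => hth.
  pose a := \sum_i `|xi 0 i|.
  have a0 : 0 <= a by exact: sumr_ge0.
  have ha i : `|xi 0 i| <= a by rewrite /a (bigD1 i)//= lerDl sumr_ge0.
  pose g := dotR th xi - Lambda_c q th - r.
  have g0 : 0 < g by rewrite subr_gt0.
  (* Moving to a rational tilt within g/m costs g/m in Lambda and d a g/m in the linear term;
     together these stay below the margin [g]. *)
  pose m := d%:R * a + 2.
  have m0 : 0 < m by rewrite ltr_wpDl// mulr_ge0.
  have [rho hrho] := rat_vector_dense th (divr_gt0 g0 m0).
  exists rho => //; rewrite /f /=.
  have h2 : Lambda_c q (ratv rho) <= Lambda_c q th + g / m.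
    by apply: (Lambda_lip d0 c10 qc) => i; rewrite distrC.
  have h3 : `|dotR (th - ratv rho) xi| <= d%:R * (g / m * a).
    by apply: dotR_le => // i; have := hrho i; rewrite !mxE.
  move: h3; rewrite dotRBl ler_norml => /andP[h3 h4].
  have : g / m + d%:R * (g / m * a) < g.
    rewrite (_ : _ + _ = g * (d%:R * a + 1) / m); last by ring.
    by rewrite ltr_pdivrMr// ltr_pM2l// /m; lra.
  by move: h2 h4; rewrite /g; lra.
pose Ds : seq 'rV[rat]_d := finmap.enum_fset D.
apply/lee_addgt0Pr => eps eps0; rewrite -EFinD.
have [N1 hN1] := eventually_all (fun (rho : 'rV[rat]_d) (_ : rho \in Ds) => mgf_upper rho).
have [N2 hN2] := square_le_exp (size Ds)%:R eps0.
apply: limn_esup_le_eventually; exists (maxn 1 (maxn N1 N2)) => n.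
rewrite !geq_max => /and3P[n0 /hN1 h1 /hN2 h2].
apply: elog_le => //.
have n0' : n%:R != 0 :> R by rewrite pnatr_eq0 -lt0n.
have expand th (s : {ffun 'I_n -> step d}) :
    expR (- (n%:R * (r + Lambda_c q th))) * expR (dotR th (pos s)) =
    expR (n%:R * (dotR th (n%:R^-1 *: pos s) - (r + Lambda_c q th))).
  by rewrite -expRD dotRZr; congr expR; field.
apply: (@le_trans _ _ (\sum_(rho <- Ds)
    expR (- (n%:R * (r + Lambda_c q (ratv rho)))) * quenched_mgf (ratv rho) n)).
  under eq_bigr do rewrite quenched_mgfE mulr_sumr.
  rewrite exchange_big /=; apply: ler_sum => s _.
  under eq_bigr do rewrite mulrCA.
  rewrite -mulr_sumr -/(weight s) -/(pos s) ler_wpM2l ?weight_ge0//.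
  rewrite indicE; case: (boolP (_ \in G)) => [yG|_]; last first.
    by apply: sumr_ge0 => rho _; rewrite mulr_ge0 ?expR_ge0.
  have [rho /= rhoD] := hD _ (subset_closure (set_mem yG)); rewrite /f /= => hrho.
  rewrite (big_rem rho rhoD) /=; apply: ler_wpDr.
    by apply: sumr_ge0 => rho' _; rewrite mulr_ge0 ?expR_ge0.
  rewrite expand -[leLHS]expR0 ler_expR mulr_ge0// subr_ge0; exact: ltW.
apply: (@le_trans _ _ (\sum_(rho <- Ds) expR (- (n%:R * r)) * n%:R ^+ 2)).
  rewrite big_seq [leRHS]big_seq; apply: ler_sum => rho /h1; rewrite mgfX => hM.
  apply: le_trans (ler_wpM2l (expR_ge0 _) hM) _.
  rewrite mulrCA -expRD mulrC le_eqVlt; apply/orP; left; apply/eqP.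
  by congr (expR _ * _); ring.
rewrite big_const_seq count_predT iter_addr_0 -[leLHS]mulr_natl.
have -> : n%:R * (- r + eps) = - (n%:R * r) + eps * n%:R by ring.
by rewrite expRD mulrCA ler_wpM2l ?expR_ge0.
Qed.

Let dotRC (u v : 'rV[R]_d) : dotR u v = dotR v u.
Proof. by apply: eq_bigr => i _; rewrite mulrC. Qed.

(** A change of measure without gradients. An endpoint outside the box overshoots by [r] in some
    direction z, so a further tilt tau z bounds its share of the moment generating function by e^(n
    (Lambda - tau r / 2)) up to n^2. This is negligible, hence the box carries at least half of the
    total. *)
Lemma ldp_lower_box (G : set 'rV[R]_d) (xi : 'rV[R]_d) (r a tau : R) (rho : 'rV[rat]_d)
    (rhoz : step d -> 'rV[rat]_d) :
  0 < r -> 0 < tau -> (forall y : 'rV[R]_d, (forall i, `|xi 0 i - y 0 i| < r) -> G y) ->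
  (forall i, `|ratv rho 0 i| <= a) ->
  (forall z, ratv (rhoz z) = ratv rho + tau *: zvec R z) ->
  (forall z, Lambda_c q (ratv (rhoz z)) - Lambda_c q (ratv rho) - tau * dotR (zvec R z) xi
     <= tau * r / 2) ->
  (forall eps, 0 < eps -> exists N, forall n, (N <= n)%N ->
    mgf q (ratv rho) ^+ n * expR (- (eps * n%:R)) <= quenched_mgf (ratv rho) n) ->
  ((- (dotR (ratv rho) xi - Lambda_c q (ratv rho)) - d%:R * (a * r))%:E <=
    limn_einf (ldp_seq omega t G))%E.
Proof.
move=> r0 tau0 hG ha hz hL hM; set th := ratv rho in ha hz hL hM *.
apply/lee_addgt0Pr => eps0 eps00; rewrite -leeBlDr// -EFinB.
(* tau r / 4 separates the outside rate Lambda - 2 eps from the total rate Lambda - eps; eps0 / 2 is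
   there because 2 eps is lost in the end. *)
pose eps := Num.min (eps0 / 2) (tau * r / 4).
have eps_gt0 : 0 < eps by rewrite lt_min !divr_gt0// mulr_gt0.
have eps1 : 2 * eps <= eps0.
  have : eps <= eps0 / 2 by rewrite ge_min lexx.
  lra.
have eps2 : 4 * eps <= tau * r.
  have : eps <= tau * r / 4 by rewrite ge_min lexx orbT.
  lra.
have [N1 hN1] := hM eps eps_gt0.
have [N2 hN2] := eventually_all (s := index_enum (step d)) (fun z _ => mgf_upper (rhoz z)).
pose K : R := 2 * #|{: step d}|%:R.
have [N3 hN3] := square_le_exp K eps_gt0.
apply: limn_einf_ge_eventually; exists (maxn 1 (maxn N1 (maxn N2 N3))) => n.
rewrite !geq_max => /and4P[n0 /hN1 h1 /hN2 h2 /hN3 h3].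
apply: elog_ge => //.
have n0' : n%:R != 0 :> R by rewrite pnatr_eq0 -lt0n.
have n0R : 0 < n%:R :> R by rewrite ltr0n.
set Q := quenched_prob omega t n G.
have split_mgf : quenched_mgf th n <= expR (n%:R * (dotR th xi + d%:R * (a * r))) * Q +
    \sum_z expR (- (n%:R * (tau * (r + dotR (zvec R z) xi)))) * quenched_mgf (ratv (rhoz z)) n.
  rewrite quenched_mgfE; under [X in _ + X]eq_bigr do rewrite quenched_mgfE mulr_sumr.
  rewrite exchange_big /= /Q /quenched_prob mulr_sumr -big_split /=; apply: ler_sum => s _.
  rewrite -/(weight s) -/(pos s).
  under eq_bigr do rewrite mulrCA.
  rewrite -mulr_sumr mulrCA -mulrDr ler_wpM2l ?weight_ge0//.
  set y := n%:R^-1 *: pos s.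
  have posE : pos s = n%:R *: y by rewrite /y scalerA mulfV// scale1r.
  have term0 z : 0 <= expR (- (n%:R * (tau * (r + dotR (zvec R z) xi)))) *
      expR (dotR (ratv (rhoz z)) (pos s)) by rewrite mulr_ge0 ?expR_ge0.
  have far z : r <= dotR (zvec R z) (y - xi) -> expR (dotR th (pos s)) <=
      \sum_z expR (- (n%:R * (tau * (r + dotR (zvec R z) xi)))) *
      expR (dotR (ratv (rhoz z)) (pos s)).
    move=> hfar; rewrite (bigD1 z)//=; apply: ler_wpDr; first exact: sumr_ge0.
    rewrite -expRD ler_expR hz dotRDl dotRZl posE !(dotRZr n%:R).
    move: hfar; rewrite dotRBr => hfar; rewrite -subr_ge0.
    rewrite (_ : _ - _ = n%:R * tau * (dotR (zvec R z) y - dotR (zvec R z) xi - r)); last by ring.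
    by apply: mulr_ge0; [rewrite mulr_ge0 ?(ltW tau0)|lra].
  have coord i : (y - xi) 0 i = y 0 i - xi 0 i by rewrite mxE [(- xi) 0 i]mxE.
  have ind0 : 0 <= expR (n%:R * (dotR th xi + d%:R * (a * r))) * \1_G y.
    by rewrite mulr_ge0 ?expR_ge0// indicE.
  have [/forallP near|] := boolP [forall i, `|xi 0 i - y 0 i| < r].
    apply: ler_wpDr; first exact: sumr_ge0.
    rewrite indicE mem_set ?mulr1; last exact: hG.
    rewrite ler_expR posE (dotRZr n%:R) ler_wpM2l ?(ltW n0R)//.
    have h (i : 'I_d) : `|(y - xi) 0 i| <= r by rewrite coord distrC ltW.
    have := dotR_le ha h; rewrite dotRBr ler_norml; lra.
  rewrite negb_forall => /existsP[i]; rewrite -leNgt => hi; apply: ler_wpDl => //.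
  move: hi; rewrite ler_normr => /orP[hi|hi].
    by apply: (far (i, false)); rewrite dotRC dotR_zvec /= coord; lra.
  by apply: (far (i, true)); rewrite dotRC dotR_zvec /= coord; lra.
have err : \sum_z expR (- (n%:R * (tau * (r + dotR (zvec R z) xi)))) * quenched_mgf (ratv (rhoz z)) n
    <= expR (n%:R * (Lambda_c q th - eps)) / 2.
  apply: (@le_trans _ _ (\sum_(z : step d) n%:R ^+ 2 * expR (n%:R * (Lambda_c q th - 2 * eps)))).
    apply: ler_sum => z _; have := h2 z (mem_index_enum _); rewrite mgfX => hMz.
    apply: le_trans (ler_wpM2l (expR_ge0 _) hMz) _.
    rewrite mulrCA -expRD ler_wpM2l ?sqr_ge0// ler_expR -mulrN -mulrDr ler_wpM2l ?(ltW n0R)//.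
    by have := hL z; lra.
  rewrite sumr_const -[leLHS]mulr_natl ler_pdivlMr//.
  have -> : n%:R * (Lambda_c q th - eps) = eps * n%:R + n%:R * (Lambda_c q th - 2 * eps) by ring.
  rewrite expRD.
  have := ler_wpM2r (expR_ge0 (n%:R * (Lambda_c q th - 2 * eps))) h3.
  by apply: le_trans; rewrite le_eqVlt; apply/orP; left; apply/eqP; rewrite /K; ring.
have main : expR (n%:R * (Lambda_c q th - eps)) / 2 <=
    expR (n%:R * (dotR th xi + d%:R * (a * r))) * Q.
  move: h1; rewrite mgfX -expRD (_ : _ + _ = n%:R * (Lambda_c q th - eps)); last by ring.
  by move: split_mgf err; lra.
have two : 2 <= expR (eps * n%:R).
  apply: le_trans h3; rewrite /K -mulrA -[leLHS]mulr1 ler_wpM2l//.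
  rewrite -[leLHS]mulr1; apply: ler_pM => //.
    by rewrite ler1n; apply/card_gt0P; exists (Ordinal d0, true).
  by rewrite exprn_ege1// ler1n.
rewrite -(ler_pM2l (expR_gt0 (n%:R * (dotR th xi + d%:R * (a * r))))).
apply: le_trans main; rewrite -expRD ler_pdivlMr//.
apply: (@le_trans _ _ (expR (n%:R * (Lambda_c q th - 2 * eps)) * expR (eps * n%:R))).
  apply: ler_pM => //; rewrite ?expR_ge0// ler_expR -mulrDr ler_wpM2l ?(ltW n0R)//; lra.
rewrite -expRD ler_expR le_eqVlt; apply/orP; left; apply/eqP; ring.
Qed.

(* Instead of solving [grad Lambda = xi], take a near-minimiser of
   [Lambda - <., xi>] over the rational points of a box: the bound on second
   differences makes its one-sided increments almost nonpositive. *)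
Lemma ldp_lower (G : set 'rV[R]_d) (xi : 'rV[R]_d) (tau0 : R) :
  0 < tau0 -> tau0 <= 1 / 2 ->
  (forall rho : 'rV[rat]_d, (forall i, `|ratv rho 0 i| <= tau0) ->
    forall eps, 0 < eps -> exists N, forall n, (N <= n)%N ->
    mgf q (ratv rho) ^+ n * expR (- (eps * n%:R)) <= quenched_mgf (ratv rho) n) ->
  nbhs xi G ->
  (forall i, `|(xi - xi_o q) 0 i| <= ln (1 + c1 * (tau0 / 2) ^+ 2 / 2) / (2 * (d%:R * tau0))) ->
  (- I_c q xi <= limn_einf (ldp_seq omega t G))%E.
Proof.
move=> tau00 tau0h hlow /nbhs_boxP[r1 r10 hG].
set kap := ln _ => hxi.
have dR : 0 < d%:R :> R by rewrite ltr0n.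
have kap0 : 0 < kap.
  rewrite ln_gt0// ltrDl !mulr_gt0// ?exprn_gt0 ?divr_gt0//.
apply/lee_addgt0Pr => eps eps0.
have dt0 : 0 < d%:R * tau0 by exact: mulr_gt0.
pose r := Num.min r1 (eps / (d%:R * tau0)).
have r0 : 0 < r by rewrite lt_min r10 divr_gt0.
have r_r1 : r <= r1 by rewrite ge_min lexx.
have r_eps : d%:R * (tau0 * r) <= eps.
  by rewrite mulrA mulrC -ler_pdivlMr// ge_min lexx orbT.
(* r/6 makes the total defect 3 tau^2 (near-minimality plus second difference) at most tau r / 2;
   1/3 is the range of [Lambda_second_difference]; kap/2 confines the near-minimiser to the half
   box; tau0/2 leaves room for one shift. As a reciprocal integer, [tau] keeps shifted tilts
   rational. *)
pose b := Num.min (r / 6) (Num.min (1 / 3) (Num.min (kap / 2) (tau0 / 2))).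
have b0 : 0 < b by rewrite !lt_min !divr_gt0.
pose N := Num.truncn b^-1.
pose tau : R := N.+1%:R^-1.
have tau_gt0 : 0 < tau by rewrite invr_gt0.
have tau_b : tau <= b by rewrite -[leRHS]invrK lef_pV2 ?posrE ?invr_gt0// ltW// truncnS_gt.
have t1 : 6 * tau <= r.
  have : tau <= r / 6 by apply: le_trans tau_b _; rewrite ge_min lexx.
  lra.
have t2 : tau <= 1 / 3 by apply: le_trans tau_b _; rewrite !ge_min lexx !orbT.
have t3 : tau <= kap / 2 by apply: le_trans tau_b _; rewrite !ge_min lexx !orbT.
have t4 : tau <= tau0 / 2 by apply: le_trans tau_b _; rewrite !ge_min lexx !orbT.
have tau2 : tau ^+ 2 <= kap / 2.
  by apply: le_trans t3; rewrite expr2 ler_piMr ?ltW//; lra.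
pose F (th : 'rV[R]_d) := Lambda_c q th - dotR th xi.
pose box (rho : 'rV[rat]_d) := forall i, `|ratv rho 0 i| <= tau0.
pose S := [set F (ratv rho) | rho in [set rho | box rho]].
have box0 : box 0 by move=> i; rewrite map_mx0 mxE normr0 ltW.
have F0 : F (ratv (0 : 'rV[rat]_d)) = 0.
  rewrite map_mx0 /F (Lambda0 q1) /dotR big1 ?subrr// => i _; by rewrite mxE mul0r.
have infS : has_inf S.
  split; first by exists 0; exists 0.
  pose a := \sum_i `|xi 0 i|.
  have ha i : `|xi 0 i| <= a by rewrite /a (bigD1 i)//= lerDl sumr_ge0.
  exists (- tau0 - d%:R * (tau0 * a)) => _ [rho hrho <-].
  have h1 : Lambda_c q (0 : 'rV[R]_d) <= Lambda_c q (ratv rho) + tau0.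
    by apply: (Lambda_lip d0 c10 qc) => i; rewrite mxE sub0r normrN.
  have := dotR_le hrho ha; move: h1; rewrite (Lambda0 q1) /F ler_norml; lra.
have [_ [rho hrho <-] hinf] := inf_adherent (exprn_gt0 2 tau_gt0) infS.
have Fmin rho' : box rho' -> F (ratv rho) < F (ratv rho') + tau ^+ 2.
  move=> h; apply: lt_le_trans hinf _; rewrite lerD2r.
  by apply: ge_inf; [exact: infS.2|exists rho'].
(* Outside the half box coercivity gives [kap], of which the term in xi - xi_o takes back at most
   kap/2; the value of [F] there is too large compared with F(0) = 0. *)
have interior_rho i : `|ratv rho 0 i| <= tau0 / 2.
  rewrite leNgt; apply/negP => hi.
  have h1 := Lambda_coercive d0 c10 qc q1 i tau0h hrho.
  have h2 : kap <= ln (1 + c1 * ratv rho 0 i ^+ 2 / 2).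
    rewrite ler_ln ?posrE; last 2 first.
    - by rewrite ltr_wpDr// divr_ge0// mulr_ge0 ?(ltW c10)// sqr_ge0.
    - by rewrite ltr_wpDr// divr_ge0// mulr_ge0 ?(ltW c10)// sqr_ge0.
    rewrite lerD2l ler_wpM2r// ler_wpM2l ?(ltW c10)//.
    rewrite -[leRHS]real_normK ?num_real// lerXn2r ?nnegrE ?divr_ge0 ?(ltW tau00)//.
    exact: ltW.
  have := dotR_le hrho hxi; rewrite dotRBr.
  rewrite (_ : d%:R * _ = kap / 2); last by field; rewrite !gt_eqF.
  have := Fmin 0 box0; rewrite F0 /F ler_norml; lra.
pose sh (z : step d) : 'rV[rat]_d := N.+1%:R^-1 *: map_mx (fun a : int => a%:~R) (stepvec z).
have shE z : ratv (sh z) = tau *: zvec R z.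
  apply/matrixP => i j; rewrite /sh /zvec [LHS]mxE [X in ratr X]mxE [X in ratr (_ * X)]mxE.
  by rewrite [RHS]mxE [X in _ = _ * X]mxE rmorphM fmorphV rmorph_nat rmorph_int.
have step_le z i : `|zvec R z 0 i| <= 1.
  rewrite /zvec /stepvec !mxE.
  by case: z.2; case: (_ && _); rewrite ?mulr1 ?mulr0 ?rmorphN ?rmorph1 ?rmorph0 ?normrN ?normr1 ?normr0.
have lower := @ldp_lower_box G xi r tau0 tau rho (fun z => rho + sh z) r0 tau_gt0 _ hrho.
have {}lower : ((- (dotR (ratv rho) xi - Lambda_c q (ratv rho)) - d%:R * (tau0 * r))%:E <=
    limn_einf (ldp_seq omega t G))%E.
  apply: lower.
  - by move=> y hy; apply: hG => i; exact: lt_le_trans (hy i) r_r1.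
  - by move=> z; rewrite map_mxD shE.
  - move=> z; rewrite map_mxD shE.
    (* Near-minimality is tested at the backward shift; the second-difference bound then converts it
       into an upper bound on the forward increment. *)
    have hm : ratv (rho - sh z) = ratv rho - tau *: zvec R z by rewrite map_mxB shE.
    have bm : box (rho - sh z).
      move=> i; rewrite hm mxE [X in _ + X]mxE [X in - X]mxE.
      apply: le_trans (ler_normB _ _) _; have h1 := interior_rho i.
      have : `|tau * zvec R z 0 i| <= tau by rewrite normrM (gtr0_norm tau_gt0) ler_piMr// ltW.
      by move: h1 t4; lra.
    have := Fmin _ bm; rewrite hm /F dotRBl dotRZl => h1.
    have tau03 : 0 <= tau <= 1 / 3 by rewrite ltW.
    have h2 := Lambda_second_difference d0 c10 qc (ratv rho) z tau03.
    have h3 : tau * (6 * tau) <= tau * r by rewrite ler_wpM2l// ltW.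
    by move: h1 h2 h3; rewrite expr2; lra.
  - exact: hlow.
have hI : ((dotR (ratv rho) xi - Lambda_c q (ratv rho))%:E <= I_c q xi)%E.
  by apply: ereal_sup_ubound; exists (ratv rho).
apply: (@le_trans _ _ (- (dotR (ratv rho) xi - Lambda_c q (ratv rho))%:E)%E); first by rewrite leeN2.
rewrite -leeBlDr//; apply: le_trans lower.
by rewrite -EFinN -EFinB lee_fin lerB.
Qed.

End quenched_ldp.

(** * Common almost sure event and proof of the theorem *)

Lemma ae_forall_count (R : realType) (dT : measure_display) (T : measurableType dT)
    (P : probability T R) (I : countType) (Q : I -> T -> Prop) :
  (forall i, {ae P, forall t, Q i t}) -> {ae P, forall t, forall i, Q i t}.
Proof.
move=> h; have : {ae P, forall t, forall n, if unpickle n is Some i then Q i t else True}.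
  by apply: ae_foralln => n; case: (unpickle n) => [i|]; [exact: h|exact: aeW].
by apply: filterS => t hn i; have := hn (pickle i); rewrite pickleK.
Qed.

Lemma ae_elliptic (R : realType) (d : nat) (dT : measure_display)
    (T : measurableType dT) (P : probability T R)
    (omega : int -> 'rV[int]_d -> T -> step d -> R) (c1 : R) :
  (forall n x z, measurable_fun setT (fun t => omega n x t z)) ->
  env_identically_distributed P omega ->
  (forall z, P [set t | c1 <= omega 0 0 t z] = 1%E) ->
  {ae P, forall t, forall k : int * 'rV[int]_d * step d, c1 <= omega k.1.1 k.1.2 t k.2}.
Proof.
move=> momega ident elliptic; apply: ae_forall_count => -[[n x] z] /=.
pose C := (fun v : step d -> R => v z) @^-1` `[c1, +oo[%classic.
have CE m y : omega m y @^-1` C = [set t | c1 <= omega m y t z].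
  by apply/seteqP; split => t; rewrite /C /= in_itv /= andbT.
have mC : cyl_sigma C by apply: cyl_measurable_coord; exact: measurable_itv.
have P1 : P [set t | c1 <= omega n x t z] = 1%E by rewrite -CE ident// CE elliptic.
have mA : measurable [set t | c1 <= omega n x t z] by exact/measurable_superlevel/momega.
apply/negligibleP; first exact: measurableC.
have P0 : P (~` [set t | c1 <= omega n x t z]) = 0%E by rewrite probability_setC// P1 subee.
exact: P0.
Qed.

Lemma eucl_ge (R : realType) d (v : 'rV[R]_d) i : `|v 0 i| <= eucl v.
Proof.
rewrite -sqrtr_sqr; apply: ler_wsqrtr; rewrite (bigD1 i)//= lerDl.
by apply: sumr_ge0 => j _; exact: sqr_ge0.
Qed.

(** Reduces the upper bound to real levels, since the infimum of the rate function is +oo when the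
    closure is empty. *)
Lemma ereal_le_lt_real (R : realType) (x y : \bar R) :
  (forall r : R, (r%:E < x)%E -> (r%:E <= y)%E) -> (x <= y)%E.
Proof.
case: x => [a h| h|_]; last exact: leNye.
- apply/lee_subgt0Pr => e e0; rewrite -EFinB; apply: h.
  by rewrite lte_fin ltrBlDr ltrDl.
- by rewrite leye_eq; apply/eqP/eqyP => A _; apply: h; rewrite ltry.
Qed.

Theorem theorem1p16 (R : realType) (d : nat) (dT : measure_display)
  (T : measurableType dT) (P : probability T R)
  (omega : int -> 'rV[int]_d -> T -> step d -> R) (c1 : R) :
  (3 <= d)%N ->
  (forall n x z, measurable_fun setT (fun t => omega n x t z)) ->
  (forall n x t z, 0 <= omega n x t z) ->
  (forall n x t, \sum_(z : step d) omega n x t z = 1) ->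
  env_independent P omega ->
  env_identically_distributed P omega ->
  0 < c1 ->
  (forall z, P [set t | c1 <= omega 0 0 t z] = 1%E) ->
  exists eta : R, 0 < eta /\
    {ae P, forall t, forall G : set 'rV[R]_d,
       borel_set G ->
       G `<=` [set xi | eucl (xi - xi_o (qmean P omega)) < eta] ->
       (- ereal_inf (I_c (qmean P omega) @` G°) <= limn_einf (ldp_seq omega t G))%E /\
       (limn_einf (ldp_seq omega t G) <= limn_esup (ldp_seq omega t G))%E /\
       (limn_esup (ldp_seq omega t G) <= - ereal_inf (I_c (qmean P omega) @` closure G))%E}.
Proof.
move=> d3 momega omega0 omega1 indep ident c10 elliptic.
have d0 : (0 < d)%N by exact: leq_trans d3.
have i0 := Ordinal d0.
set q := qmean P omega.
have qc z : c1 <= q z by exact: qmean_ge.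
have q1 : \sum_z q z = 1 by exact: qmean_sum.
have tilt0 (th : 'rV[R]_d) z : 0 < tilt th z by exact: expR_gt0.
have [tau [tau0 tau12 replica]] := replica_bound d3 momega omega0 omega1 indep ident c10 elliptic.
(* This radius makes d tau eta equal to half of the coercivity level at tau/2, as [ldp_lower]
   demands. *)
pose eta := ln (1 + c1 * (tau / 2) ^+ 2 / 2) / (2 * (d%:R * tau)).
exists eta; split.
  rewrite divr_gt0// ?mulr_gt0 ?ltr0n// ln_gt0// ltrDl divr_gt0// mulr_gt0//.
  by rewrite exprn_gt0// divr_gt0.
have upper : {ae P, forall t, forall rho : 'rV[rat]_d, exists N, forall n, (N <= n)%N ->
    quenched_mgf omega t (map_mx ratr rho) n <= n%:R ^+ 2 * mgf q (map_mx ratr rho) ^+ n}.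
  apply: ae_forall_count => rho.
  apply: filterS (partition_upper d3 momega omega0 omega1 indep ident c10 elliptic
    (tilt0 (map_mx ratr rho))) => t [N hN].
  by exists N => n /hN.
have blocks : {ae P, forall t, forall rho : 'rV[rat]_d, (forall i, `|map_mx ratr rho 0 i| <= tau) ->
    exists N, forall k, (N <= k)%N -> exists2 j, (j < k ^ 2)%N &
    1 / 2 <= partition omega (fun z => (mgf q (map_mx ratr rho))^-1 * tilt (map_mx ratr rho) z)
      (block k) (warmup k) (start i0 k j) t}.
  apply: ae_forall_count => rho.
  have [hrho|nrho] := pselect (forall i, `|map_mx ratr rho 0 i| <= tau); last by apply: aeW.
  set th : 'rV[R]_d := map_mx ratr rho in hrho *.
  have m0 : 0 < mgf q th by exact: (mgf_gt0 d0 c10 qc).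
  have tiltP z : expR (- tau) <= tilt th z <= expR tau.
    have := hrho z.1; rewrite ler_norml => /andP[h1 h2].
    by rewrite /tilt dotR_zvec !ler_expR; case: z.2; lra.
  have mgfP : expR (- tau) <= mgf q th <= expR tau.
    have sumq (c : R) : \sum_z q z * c = c by rewrite -mulr_suml q1 mul1r.
    rewrite -[expR (- tau)]sumq -[expR tau]sumq.
    apply/andP; split; apply: ler_sum => z _; have /andP[h1 h2] := tiltP z.
      by rewrite ler_wpM2l// (le_trans _ (qc z))// ltW.
    by rewrite ler_wpM2l// (le_trans _ (qc z))// ltW.
  have e1 : \sum_z q z * ((mgf q th)^-1 * tilt th z) = 1.
    by under eq_bigr do rewrite mulrCA; rewrite -mulr_sumr mulVf// gt_eqF.
  (* Both the tilt and its mean lie between e^(-tau) and e^tau; their ratio falls in the range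
     allowed by the replica bound. *)
  have eP z : expR (- (2 * tau)) <= (mgf q th)^-1 * tilt th z <= expR (2 * tau).
    have /andP[h1 h2] := tiltP z; have /andP[g1 g2] := mgfP.
    have -> : - (2 * tau) = - tau + - tau by ring.
    have -> : 2 * tau = tau + tau by ring.
    have v1 : expR (- tau) <= (mgf q th)^-1 by rewrite expRN lef_pV2 ?posrE ?expR_gt0.
    have v2 : (mgf q th)^-1 <= expR tau.
      by rewrite -[expR tau]invrK -expRN lef_pV2 ?posrE ?expR_gt0.
    rewrite !expRD; apply/andP; split; apply: ler_pM;
      by rewrite ?expR_ge0 ?invr_ge0 ?(ltW m0) ?(ltW (tilt0 _ _)).
  have [psi [psi01 decay hpsi]] := replica _ eP e1.
  have := good_blocks momega omega0 omega1 indep ident i0 e1 psi01 decay hpsi.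
  by apply: filterS => t ht _.
have ell := ae_elliptic momega ident elliptic.
(* The three events do not involve [G], so one null set serves all Borel sets. *)
apply: filterS3 upper blocks ell => t upper blocks ell G _ hG.
have hGi xi : G xi -> forall i, `|(xi - xi_o q) 0 i| <= eta.
  by move=> /hG /= h i; apply: le_trans (eucl_ge _ _) (ltW h).
split; last split; last 1 first.
- rewrite leeNr; apply: ereal_le_lt_real => r hr; rewrite leeNr -EFinN.
  have [b hb] : exists b : R, forall y, G y -> forall i, `|y 0 i| <= b.
    exists (eta + \sum_i `|xi_o q 0 i|) => y Gy i.
    rewrite -[y 0 i](subrK (xi_o q 0 i)); apply: le_trans (ler_normD _ _) _.
    apply: lerD; first by have := hGi y Gy i; rewrite mxE [X in _ + X]mxE.
    by rewrite (bigD1 i)//= lerDl sumr_ge0.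
  apply: (ldp_upper d0 c10 qc (fun n x => omega0 n x t) upper hb) => xi hxi.
  by apply: lt_le_trans hr _; apply: ereal_inf_lbound; exists xi.
- rewrite leeNl; apply: le_ereal_inf_tmp => _ [xi Gxi <-]; rewrite leeNl.
  apply: (ldp_lower d0 c10 qc q1 (fun n x => omega0 n x t) upper tau0 tau12) => //.
    move=> rho hrho; apply: (partition_lower d3 momega omega0 omega1 c10 elliptic (expR_gt0 (- tau)) _ _
      (blocks rho hrho)).
      move=> z; have := hrho z.1; rewrite ler_norml => /andP[h1 h2].
      by rewrite /tilt dotR_zvec ler_expR; case: z.2; lra.
    by move=> n y z; exact: (ell (n, y, z)).
  by apply: hGi; exact: interior_subset Gxi.
- exact: limn_einf_sup.
Qed.
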